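(* Let $G=(V,E)$ be a graph with $n$ vertices and maximum degree $\Delta$. Given a 2-minimal maximal independent set $S$ of $G$ (maintained in the data structure described in the context), one can, in $O(n\Delta^3)$ time, either find a maximal independent set $S'$ in the 3-neighborhood of $S$ with $|S'|<|S|$, or conclude that $S$ is 3-minimal.
   Context: $G=(V,E)$ is a simple undirected graph, $N(v)=\{u\mid uv\in E\}$, $\deg(v)=|N(v)|$, $\Delta=\max_v\deg(v)$. A solution is a maximal independent set of $G$. For a solution $S$ and $v\notin S$, the tightness of $v$ is $\tau(v)=|N(v)\cap S|$; $v$ is $t$-tight if $\tau(v)=t$, and $T_t$ denotes the set of $t$-tight vertices. For $k\ge1$, a $k$-swap on $S$ produces a solution $(S\setminus D)\cup A$ with $D$ a $k$-element subset of $S$ and $A$ a nonempty subset of $V\setminus S$; the $k$-neighborhood of $S$ is the set of all solutions so obtainable; $S$ is $k$-minimal if its $k$-neighborhood contains no solution of size smaller than $|S|$. Data structure: the graph is stored by adjacency lists; the current solution is maintained by an ordering of $V$ partitioned into consecutive sections $S$, $T_0$, $T_1$, $T_2$, $T_{\ge 3}$ (with the size of each section stored), together with $\tau(v)$ for every non-solution vertex; this supports scanning each section in time linear in its size, testing membership in $S$ in $O(1)$ time, and adding or dropping a vertex $v$ to/from the solution in $O(\deg(v))$ time; each vertex also carries auxiliary integer counters readable and writable in $O(1)$ time. *)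

(* Defs.v *)
From HB Require Import structures.
From mathcomp Require Import all_boot.

Set Implicit Arguments.
Unset Strict Implicit.
Unset Printing Implicit Defensive.

Section Graph.

Variables (T : finType) (e : rel T).

Definition simple_graph : Prop := symmetric e /\ irreflexive e.

Definition nbh (v : T) : {set T} := [set u | e v u].

Definition deg (v : T) : nat := #|nbh v|.

Definition max_degree : nat := \max_(v : T) deg v.

Definition independent (A : {set T}) : bool :=
  [forall u in A, forall v in A, ~~ e u v].

Definition solution (S : {set T}) : bool := maxset independent S.

Definition tau (S : {set T}) (v : T) : nat := #|nbh v :&: S|.

Definition neighborhood (k : nat) (S S' : {set T}) : Prop :=
  exists D A : {set T},
    [/\ D \subset S /\ #|D| = k, A != set0 /\ A \subset ~: S,
        S' = (S :\: D) :|: A & solution S'].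

Definition minimal (k : nat) (S : {set T}) : Prop :=
  forall S' : {set T}, neighborhood k S S' -> ~~ (#|S'| < #|S|).

(* The order of each list is arbitrary. *)
Definition adjacency_lists (adj : T -> seq T) : Prop :=
  forall v : T, uniq (adj v) /\ (forall u : T, (u \in adj v) = e v u).

End Graph.

(* Programs are finite syntax that does not mention the graph, so that one
   program serves all graphs and every computation step is charged for.
   Integer arithmetic is limited to +1 and -1: integers then grow by at most
   one per time unit, so unit cost cannot be abused by packing work into
   long words. *)

Inductive section := SecS | SecT0 | SecT1 | SecT2 | SecT3up.

(* Registers and counters are named by natural numbers; there are vertex
   registers (v, u), integer registers (i, j), and cursors (p) pointing to a
   cell of an adjacency list. A counter k holds one integer per vertex. *)
Inductive instr :=
  | VCopy (v u : nat)                  (* v := u                              *)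
  | VNth (v : nat) (s : section) (i : nat)
                                       (* v := i-th vertex of section s       *)
  | VHead (v p : nat)                  (* v := vertex in the cell p points to *)
  | PAdj (p v : nat)                   (* p := first cell of the list of v    *)
  | PNext (p : nat)                    (* p := next cell                      *)
  | IConst (i c : nat)                 (* i := c                              *)
  | ICopy (i j : nat)                  (* i := j                              *)
  | IInc (i : nat)                     (* i := i + 1                          *)
  | IDec (i : nat)                     (* i := i - 1, truncated at 0          *)
  | ISize (i : nat) (s : section)      (* i := size of section s              *)
  | ITau (i v : nat)                   (* i := tau(v), for v not in S         *)
  | IGet (i k v : nat)                 (* i := counter k of v                 *)
  | ISet (k v i : nat)                 (* counter k of v := i                 *)
  | SAdd (v : nat)                     (* add v, free, to the solution        *)
  | SDrop (v : nat).                   (* drop v from the solution            *)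

Inductive test :=
  | TIn (v : nat)                      (* v is in the solution *)
  | TEqV (v u : nat)
  | TEqI (i j : nat)
  | TLtI (i j : nat)
  | TNil (p : nat)                     (* p is past the end of its list *)
  | TNot (b : test).

Inductive cmd :=
  | Skip
  | Do (a : instr)
  | Seq (c1 c2 : cmd)
  | If (b : test) (c1 c2 : cmd)
  | While (b : test) (c : cmd).

(* The data structure is the pair (sol, ord); section sizes and tightnesses are
   determined by it. A cursor is represented by the rest of its list. *)
Record state (T : finType) := State {
  sol : {set T};
  ord : seq T;
  vreg : nat -> option T;
  ireg : nat -> nat;
  preg : nat -> seq T;
  cnt : nat -> T -> nat
}.

Section Semantics.

Variables (T : finType) (e : rel T) (adj : T -> seq T).
Implicit Types (S : {set T}) (st : state T).

Definition section_rank (s : section) : nat :=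
  match s with
  | SecS => 0 | SecT0 => 1 | SecT1 => 2 | SecT2 => 3 | SecT3up => 4
  end.

Definition rank S (v : T) : nat :=
  if v \in S then 0 else (minn (tau e S v) 3).+1.

Definition rank_le S : rel T := fun u v => rank S u <= rank S v.

(* ord lists V, with the sections S, T_0, T_1, T_2, T_{>=3} consecutive. *)
Definition maintains st S : Prop :=
  [/\ sol st = S, perm_eq (ord st) (enum T) & sorted (rank_le S) (ord st)].

Definition section_seq st (s : section) : seq T :=
  [seq v <- ord st | rank (sol st) v == section_rank s].

Definition set_vreg st (v : nat) (x : T) : state T :=
  State (sol st) (ord st) [eta vreg st with v |-> Some x]
        (ireg st) (preg st) (cnt st).

Definition set_ireg st (i m : nat) : state T :=
  State (sol st) (ord st) (vreg st) [eta ireg st with i |-> m]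
        (preg st) (cnt st).

Definition set_preg st (p : nat) (l : seq T) : state T :=
  State (sol st) (ord st) (vreg st) (ireg st)
        [eta preg st with p |-> l] (cnt st).

Definition set_cnt st (k : nat) (x : T) (m : nat) : state T :=
  State (sol st) (ord st) (vreg st) (ireg st) (preg st)
        (fun k' y => if (k' == k) && (y == x) then m else cnt st k' y).

(* Moving vertices between sections: the ordering is stably re-sorted. *)
Definition set_sol st S : state T :=
  State S (sort (rank_le S) (ord st)) (vreg st) (ireg st) (preg st) (cnt st).

(* None: the instruction is not defined in this state, and execution is stuck. *)
Definition run_instr (a : instr) st : option (state T) :=
  match a with
  | VCopy v u => omap (set_vreg st v) (vreg st u)
  | VNth v s i => omap (set_vreg st v) (onth (section_seq st s) (ireg st i))
  | VHead v p => omap (set_vreg st v) (ohead (preg st p))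
  | PAdj p v => omap (fun x => set_preg st p (adj x)) (vreg st v)
  | PNext p => Some (set_preg st p (behead (preg st p)))
  | IConst i c => Some (set_ireg st i c)
  | ICopy i j => Some (set_ireg st i (ireg st j))
  | IInc i => Some (set_ireg st i (ireg st i).+1)
  | IDec i => Some (set_ireg st i (ireg st i).-1)
  | ISize i s => Some (set_ireg st i (size (section_seq st s)))
  | ITau i v =>
      obind (fun x => if x \in sol st then None
                      else Some (set_ireg st i (tau e (sol st) x))) (vreg st v)
  | IGet i k v => omap (fun x => set_ireg st i (cnt st k x)) (vreg st v)
  | ISet k v i => omap (fun x => set_cnt st k x (ireg st i)) (vreg st v)
  | SAdd v =>
      obind (fun x => if (x \notin sol st) && (tau e (sol st) x == 0)
                      then Some (set_sol st (x |: sol st)) else None)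
            (vreg st v)
  | SDrop v =>
      obind (fun x => if x \in sol st then Some (set_sol st (sol st :\ x))
                      else None) (vreg st v)
  end.

Definition cost (a : instr) st : nat :=
  match a with
  | SAdd v | SDrop v => if vreg st v is Some x then (deg e x).+1 else 1
  | _ => 1
  end.

Fixpoint run_test (b : test) st : option bool :=
  match b with
  | TIn v => omap (fun x => x \in sol st) (vreg st v)
  | TEqV v u => obind (fun x => omap (fun y => x == y) (vreg st u)) (vreg st v)
  | TEqI i j => Some (ireg st i == ireg st j)
  | TLtI i j => Some (ireg st i < ireg st j)
  | TNil p => Some (nilp (preg st p))
  | TNot b' => omap negb (run_test b' st)
  end.

(* exec c st t st': c, started in st, halts in st' after t time units. *)
Inductive exec : cmd -> state T -> nat -> state T -> Prop :=
  | ExecSkip st : exec Skip st 0 st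
  | ExecDo a st st' : run_instr a st = Some st' -> exec (Do a) st (cost a st) st'
  | ExecSeq c1 c2 st st1 st2 t1 t2 :
      exec c1 st t1 st1 -> exec c2 st1 t2 st2 ->
      exec (Seq c1 c2) st (t1 + t2) st2
  | ExecIf b r c1 c2 st st' t :
      run_test b st = Some r -> exec (if r then c1 else c2) st t st' ->
      exec (If b c1 c2) st t.+1 st'
  | ExecWhileF b c st :
      run_test b st = Some false -> exec (While b c) st 1 st
  | ExecWhileT b c st st1 st2 t1 t2 :
      run_test b st = Some true -> exec c st t1 st1 ->
      exec (While b c) st1 t2 st2 ->
      exec (While b c) st (t1 + t2).+1 st2.

Lemma exec_det c st t1 t2 st1 st2 :
  exec c st t1 st1 -> exec c st t2 st2 -> t1 = t2 /\ st1 = st2.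
Proof.
move=> H; elim: H t2 st2 => {c st t1 st1}
  [st|a st st' E|c1 c2 st sta stb ta tb _ IH1 _ IH2|b r c1 c2 st st' t E _ IH
  |b c st E|b c st sta stb ta tb E _ IH1 _ IH2] t2 st2 H;
  inversion H as [|? ? ? E'|? ? ? ? ? ? ? X Y|? ? ? ? ? ? ? E' X|? ? ? E'
                 |? ? ? ? ? ? ? E' X Y]; subst; try by [|congruence].
- by split=> //; congruence.
- have [? ?] := IH1 _ _ X; subst.
  by have [? ?] := IH2 _ _ Y; subst.
- rewrite E in E'; case: E' => ?; subst.
  by have [? ?] := IH _ _ X; subst.
- have [? ?] := IH1 _ _ X; subst.
  by have [? ?] := IH2 _ _ Y; subst.
Qed.

End Semantics.

(* Main.v *)
Require Import Defs.
From mathcomp Require Import all_boot zify.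

(** An improving 3-swap removes D = {x, y, z} and inserts {v, w}, possibly
    with v = w; then every solution neighbour of v and w lies in D and every
    vertex of D is adjacent to v or w. Call the pair so that v has the larger
    tightness. If v is 3-tight, D is N(v) inter S and w is adjacent to some
    x in D. Otherwise v is 2-tight, with solution neighbours x and y, and
    2-minimality provides a vertex u, neither equal nor adjacent to v, whose
    solution neighbours are among x and y; the new solution can only dominate u
    through w, so w is found in N(u), and z in N(w). Either way each v has
    O(Delta) candidate swaps, and a candidate is checked in O(Delta^2) time:
    only the closed neighbourhoods of x, y and z have to be inspected. *)

Set Implicit Arguments.
Unset Strict Implicit.
Unset Printing Implicit Defensive.

(** In the 2-tight case [v] alone does not locate its partner: a priori [w] could have [z] as its
    only solution neighbour and lie anywhere in the graph. Only the failure of the 2-swap trading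
    [x] and [y] for [v] confines it. Since every witness has to be dominated by [w], a single
    witness, picked before [w] is known, is enough. The number of candidates for [z] stays constant
    because [w] may be taken at most 2-tight; without that bound one more factor Delta would appear.
    Candidates are tested on a virtual set: membership after the swap is read off five registers and
    the current solution, and nothing is updated before a swap is accepted. A recorded swap has
    passed a complete check, so the structural argument has only to guarantee that no swap is
    missed. Time is counted in powers of Delta + 1. A vertex in a scanned section has a neighbour,
    so Delta is positive whenever a loop body runs, and the conversion to powers of Delta costs a
    factor 2^3 = 8. *)

Definition dominated (T : finType) (e : rel T) (A : {set T}) (u : T) : bool :=
  [exists h in A, e u h].

Definition swapped (T : finType) (S : {set T}) (v w x y z : T) : {set T} :=
  (S :\: [set x; y; z]) :|: [set v; w].

(** * Domination, solutions and the shape of an improving swap *)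

Section Solutions.

Variables (T : finType) (e : rel T).
Hypothesis Ge : simple_graph e.
Implicit Types (A B S : {set T}) (u v w x y z : T).

Let eC : symmetric e. Proof. by case: Ge. Qed.
Let eI u : e u u = false. Proof. by case: Ge. Qed.

Lemma dominatedP A u :
  reflect (exists2 h, h \in A & e u h) (dominated e A u).
Proof. exact: exists_inP. Qed.

Lemma dominatedS A B u :
  A \subset B -> dominated e A u -> dominated e B u.
Proof.
by move=> sAB /dominatedP[h hA euh]; apply/dominatedP; exists h;
  rewrite ?(subsetP sAB).
Qed.

Lemma tau_eq0 A u : (tau e A u == 0) = ~~ dominated e A u.
Proof.
rewrite /tau cards_eq0; apply/eqP/idP => [E|nd].
  apply/negP=> /dominatedP[h hA euh].
  by have := in_set0 h; rewrite -E !inE euh hA.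
apply/setP=> h; rewrite !inE; apply/negbTE/negP=> /andP[euh hA].
by case/dominatedP: nd; exists h.
Qed.

Lemma independentP A :
  reflect (forall u, u \in A -> ~~ dominated e A u) (independent e A).
Proof.
apply: (iffP forall_inP) => [H u uA|H u uA].
  by apply/dominatedP=> -[h hA]; apply/negP; apply: (forall_inP (H u uA)).
apply/forall_inP=> h hA; apply: contra (H u uA) => euh.
by apply/dominatedP; exists h.
Qed.

(** Independence and maximality merge into one Boolean equation per vertex, which fails exactly when
    two bits coincide. This is the form in which the program tests a set. *)
Lemma solutionP A :
  reflect (forall u, (u \in A) = ~~ dominated e A u) (solution e A).
Proof.
apply: (iffP maxsetP) => [[/independentP iA mA] u|H].
  apply/idP/idP => [/iA //|ndu].
  suff <- : u |: A = A by rewrite setU11.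
  apply: mA; last exact: subsetU1.
  apply/independentP=> a; rewrite in_setU1 => aA; apply/dominatedP=> -[h].
  rewrite in_setU1 => /orP[/eqP->|hA] eah; case/orP: aA => [/eqP ea|aA].
  - by rewrite ea eI in eah.
  - by case/dominatedP: ndu; exists a; rewrite // eC.
  - by case/dominatedP: ndu; exists h; rewrite // -ea.
  - by case/dominatedP: (iA _ aA); exists h.
split=> [|B /independentP iB sAB]; first by apply/independentP=> u; rewrite H.
apply/eqP; rewrite eqEsubset sAB andbT; apply/subsetP=> u uB; rewrite H.
apply: contra (iB u uB) => /dominatedP[h hA euh].
by apply/dominatedP; exists h; rewrite ?(subsetP sAB).
Qed.

Lemma in_swapped S v w x y z u :
  (u \in swapped S v w x y z) =
  [|| u == v, u == w | [&& u \in S, u != x, u != y & u != z]].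
Proof.
rewrite !inE !negb_or -!andbA; do !case: (_ == _) => //=.
all: by rewrite ?andbT ?andbF ?orbT ?orbF.
Qed.

(* Only vertices of the closed neighbourhoods of x, y and z can be affected
   by the swap; v and w belong to them. *)
Lemma swapped_solution S v w x y z :
  solution e S -> v \notin S -> w \notin S -> e x v -> e x w || e z w ->
  (forall r u, r \in [:: x; y; z] -> u = r \/ e r u ->
     (u \in swapped S v w x y z) = ~~ dominated e (swapped S v w x y z) u) ->
  solution e (swapped S v w x y z).
Proof.
move=> /solutionP sS vS wS exv exzw H; set S' := swapped _ _ _ _ _ _ in H *.
have vS' : ~~ dominated e S' v.
  by rewrite -(H x) ?in_swapped ?eqxx ?mem_head //; right.
have wS' : ~~ dominated e S' w.
  case/orP: exzw => erw; [rewrite -(H x)|rewrite -(H z)];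
    by [rewrite in_swapped eqxx orbT|rewrite !inE eqxx ?orbT|right].
apply/solutionP=> u.
have [[r rD rE]|far] :
  (exists2 r, r \in [:: x; y; z] & u = r \/ e r u) \/
  (forall r, r \in [:: x; y; z] -> u != r /\ e u r = false).
- case: (altP (@hasP _ (fun r => (u == r) || e r u) [:: x; y; z])).
    by case=> r rD /orP[/eqP|]; left; exists r; auto.
  move=> /hasPn nr; right=> r rD; have := nr r rD.
  by rewrite negb_or (eC u) => /andP[-> /negPf->].
- exact: H rE.
have nD : [&& u != x, u != y & u != z].
  by apply/and3P; split; apply: (far _ _).1; rewrite !inE eqxx ?orbT.
have [uS|uS] := boolP (u \in S).
  have uS' : u \in S' by rewrite in_swapped uS nD !orbT.
  rewrite uS'; symmetry; apply/dominatedP=> -[h]; rewrite in_swapped.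
  case/or3P=> [/eqP->|/eqP->|/and4P[hS _ _ _]] euh.
  - by case/dominatedP: vS'; exists u; rewrite // eC.
  - by case/dominatedP: wS'; exists u; rewrite // eC.
  - by move: uS; rewrite sS => /dominatedP[]; exists h.
have uv : u != v.
  apply/eqP=> E; have [_] := far x (mem_head _ _).
  by rewrite E eC exv.
have uw : u != w.
  apply/eqP=> E; case/orP: exzw => erw.
    by have [_] := far x (mem_head _ _); rewrite E eC erw.
  by have [|_] := far z; rewrite ?E ?inE ?eqxx ?orbT // eC erw.
rewrite in_swapped (negPf uv) (negPf uw) (negPf uS) /=; symmetry.
move: uS; rewrite sS negbK => /dominatedP[h hS euh].
apply/negbF/dominatedP; exists h => //; rewrite in_swapped hS /=.
suff -> : [&& h != x, h != y & h != z] by rewrite !orbT.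
by apply/and3P; split; apply/eqP=> E; move: euh;
  rewrite E (far _ _).2 // !inE eqxx ?orbT.
Qed.

Lemma swapped_neighborhood S v w x y z :
  uniq [:: x; y; z] -> {subset [:: x; y; z] <= S} -> v \notin S ->
  w \notin S -> solution e (swapped S v w x y z) ->
  neighborhood e 3 S (swapped S v w x y z) /\ #|swapped S v w x y z| < #|S|.
Proof.
move=> uD sD vS wS sol'.
have sDS : [set x; y; z] \subset S.
  by apply/subsetP=> u; rewrite !inE -orbA => uD'; apply: sD; rewrite !inE.
have cD : #|[set x; y; z]| = 3.
  have -> : [set x; y; z] = [set u in [:: x; y; z]].
    by apply/setP=> u; rewrite !inE -orbA.
  by rewrite cardsE; apply/card_uniqP.
split.
  exists [set x; y; z], [set v; w]; split=> //; split.
    by apply/set0Pn; exists v; rewrite set21.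
  by apply/subsetP=> u; rewrite !inE => /orP[]/eqP->.
have := cardsU (S :\: [set x; y; z]) [set v; w].
have := cardsDS sDS; have := subset_leq_card sDS.
have := cards2 v w; rewrite -/(swapped S v w x y z) cD; lia.
Qed.

(** The vertices outside the solution that satisfy this are those left undominated when [x] and [y]
    are traded for [v]. *)
Definition witness S v x y u :=
  [&& u != v, ~~ e u v & [forall h in S, e u h ==> (h \in [set x; y])]].

(** Trading [x, y] for [v] gives a smaller set, so by 2-minimality it is not a solution. It is still
    independent, hence some vertex outside it is undominated, and the solution neighbours of that
    vertex must all have been removed. *)
Lemma minimal2_wit S v x y :
  solution e S -> minimal e 2 S -> v \notin S -> x != y ->
  nbh e v :&: S = [set x; y] -> exists2 u, u \notin S & witness S v x y u.
Proof.
move=> /solutionP sS m2 vS xy nv.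
have inN h : h \in S -> e v h = (h \in [set x; y]).
  by move=> hS; rewrite -nv !inE hS andbT.
have sN : [set x; y] \subset S by rewrite -nv subsetIr.
pose S2 := (S :\: [set x; y]) :|: [set v].
have : ~~ solution e S2.
  apply/negP=> sol2; have nb : neighborhood e 2 S S2.
    exists [set x; y], [set v]; split=> //; first by rewrite cards2 xy.
    by rewrite sub1set inE vS; split=> //; apply/set0Pn; exists v;
      rewrite set11.
  apply: (negP (m2 _ nb)); have := cardsU (S :\: [set x; y]) [set v].
  have := cardsDS sN; have := subset_leq_card sN.
  by rewrite -/S2 cards1 cards2 xy; lia.
move=> nsol; have : [exists u, (u \in S2) == dominated e S2 u].
  apply: contraR nsol; rewrite negb_exists => /forallP H; apply/solutionP=> u.
  by move: (H u); case: (u \in S2); case: dominated.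
have inS2 h : (h \in S2) = (h == v) || (h \in S) && (h \notin [set x; y]).
  by rewrite !inE orbC [in RHS]andbC.
case/existsP=> u /eqP;
  have [uS2 /esym/dominatedP[h]|uS2 /esym/dominatedP ndu] := boolP (u \in S2).
  move: uS2; rewrite !inS2; case/predU1P=> [->|/andP[uS uN]].
    case/predU1P=> [->|/andP[hS hN]]; first by rewrite eI.
    by rewrite inN // (negPf hN).
  case/predU1P=> [->|/andP[hS hN]]; first by rewrite eC inN // (negPf uN).
  by move=> euh; move: uS; rewrite sS => /dominatedP[]; exists h.
move: uS2; rewrite inS2 negb_or negb_and negbK => /andP[uv uS].
have euv : ~~ e u v.
  by apply/negP=> euv; apply: ndu; exists v; rewrite // inS2 eqxx.
have {}uS : u \notin S.
  case/orP: uS => // uN; move: euv.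
  by rewrite eC inN ?uN ?(subsetP sN).
exists u => //; rewrite /witness uv euv /=; apply/forall_inP=> h hS;
  apply/implyP=> euh.
by apply/negPn/negP=> hN; apply: ndu; exists h; rewrite // inS2 hS hN orbT.
Qed.

Definition good S v w x y z :=
  [&& uniq [:: x; y; z], all (mem S) [:: x; y; z], v \notin S, w \notin S
    & solution e (swapped S v w x y z)].

Lemma card_le2 A v : #|A| <= 2 -> v \in A -> exists w, A = [set v; w].
Proof.
move=> + vA; rewrite (cardsD1 v A) vA leq_eqVlt => /orP[/cards1P[w E]|].
  by exists w; rewrite -(setD1K vA) E.
rewrite !ltnS leqn0 cards_eq0 => /eqP E; exists v.
by rewrite setUid -(setD1K vA) E setU0.
Qed.

Lemma card3P (D : {set T}) x :
  #|D| = 3 -> x \in D ->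
  exists y z, D = [set x; y; z] /\ uniq [:: x; y; z].
Proof.
move=> cD xD; have : #|D :\ x| == 2 by move: cD; rewrite (cardsD1 x) xD; lia.
case/cards2P=> y [z [yz E]]; exists y, z.
have inD u : u \in D :\ x -> u != x by rewrite !inE => /andP[].
split; first by rewrite -setUA -E setD1K.
by rewrite /= !inE negb_or yz ![x == _]eq_sym !inD // E ?set21 ?set22.
Qed.

Definition improving3 S v w x y z :=
  [/\ good S v w x y z, tau e S v = 3,
      [&& e v x, e v y & e v z] & e x w].

(** The last clause quantifies over all witnesses adjacent to [x] because the program keeps just one
    of them, chosen without knowledge of [w]. *)
Definition improving2 S v w x y z :=
  [/\ good S v w x y z, tau e S v = 2, [&& e v x, e v y & e w z],
      tau e S w <= 2 &
      [/\ exists2 u, e x u & witness S v x y u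
        & forall u, e x u -> witness S v x y u -> e u w]].

Lemma improving_swap S S' :
  solution e S -> minimal e 2 S -> neighborhood e 3 S S' -> #|S'| < #|S| ->
  exists v w x y z, improving3 S v w x y z \/ improving2 S v w x y z.
Proof.
move=> solS m2 [D [A [[DS cD] [A0 AS] ES' solS']]] ltS.
have /solutionP sS := solS; have /solutionP sS' := solS'.
have disjA h : h \in A -> h \notin S by move/(subsetP AS); rewrite inE.
have inS' h : (h \in S') = (h \in S) && (h \notin D) || (h \in A).
  by rewrite ES' !inE [in RHS]andbC.
have cA : #|A| <= 2.
  have := cardsU (S :\: D) A; have := cardsDS DS; have := subset_leq_card DS.
  have -> : (S :\: D) :&: A = set0.
    by apply/setP=> h; rewrite !inE;
      case: (boolP (h \in A)) => [/disjA/negPf->|]; rewrite ?andbF.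
  rewrite cards0 -ES' cD; lia.
have nbA a : a \in A -> nbh e a :&: S \subset D.
  move=> aA; apply/subsetP=> h; rewrite !inE => /andP[eah hS].
  apply/negPn/negP=> hD; have : a \in S' by rewrite inS' aA orbT.
  by rewrite sS' => /dominatedP[]; exists h; rewrite // inS' hS hD.
have domD h : h \in D -> exists2 a, a \in A & e a h.
  move=> hD; have hS := subsetP DS _ hD.
  have : h \notin S' by rewrite inS' hD andbF; apply: contraL hS => /disjA.
  rewrite sS' negbK => /dominatedP[a]; rewrite inS' => /orP[/andP[aS _]|aA] eha.
    by move: hS; rewrite sS => /dominatedP[]; exists a.
  by exists a; rewrite // eC.
have domS a : a \in A -> exists2 h, h \in D & e a h.
  move=> aA; have := disjA a aA; rewrite sS negbK => /dominatedP[h hS eah].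
  by exists h => //; apply: (subsetP (nbA a aA)); rewrite !inE eah.
have goodI v w x y z : A = [set v; w] -> D = [set x; y; z] ->
  uniq [:: x; y; z] -> good S v w x y z.
  move=> EA ED uD; rewrite /good /swapped uD -ED -EA -ES' solS' !disjA ?EA
    ?set21 ?set22 //=.
  rewrite !andbT.
  by apply/and3P; split; apply: (subsetP DS); rewrite ED !inE eqxx ?orbT.
have [|no3] := altP (@existsP _ (fun v => (v \in A) && (tau e S v == 3))).
  case=> v /andP[vA /eqP tv].
  have nv : nbh e v :&: S = D.
    by apply/eqP; rewrite eqEcard nbA // cD -/(tau e S v) tv.
  have inv h : h \in D -> e v h by rewrite -nv !inE => /andP[].
  have [w EA] := card_le2 cA vA.
  have [x xD ewx] : exists2 h, h \in D & e w h by apply: domS; rewrite EA set22.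
  have [y [z [ED uD]]] := card3P cD xD.
  exists v, w, x, y, z; left; split; rewrite ?(eC x) //; first exact: goodI.
  by rewrite !inv // ED !inE eqxx ?orbT.
have t2 a : a \in A -> tau e S a <= 2.
  move=> aA; have := subset_leq_card (nbA a aA).
  rewrite cD leq_eqVlt => /orP[t3|//]; case/negP: no3.
  by apply/existsP; exists a; rewrite aA.
(* The order of [x] and [y] is left free: the witness may be adjacent to only one of them, and the
   claim is applied with that one first. *)
have base v w x y u0 : A = [set v; w] -> x != y -> nbh e v :&: S = [set x; y] ->
    e x u0 -> witness S v x y u0 -> exists z, improving2 S v w x y z.
  move=> EA xy nv exu0 wu0.
  have vA : v \in A by rewrite EA set21.
  have wA : w \in A by rewrite EA set22.
  have inv h : h \in S -> e v h = (h \in [set x; y]).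
    by move=> hS; rewrite -nv !inE hS andbT.
  have sND := nbA v vA; rewrite nv in sND.
  have [xD yD] : x \in D /\ y \in D by rewrite !(subsetP sND) ?set21 ?set22.
  have : #|D :\: [set x; y]| == 1 by rewrite cardsDS // cD cards2 xy.
  case/cards1P=> z Ez; have : z \in D :\: [set x; y] by rewrite Ez set11.
  rewrite in_setD => /andP[zN zD]; have zS := subsetP DS z zD.
  have ewz : e w z.
    have [a] := domD z zD; rewrite EA => /set2P[]-> //.
    by rewrite inv // (negPf zN).
  have ED : D = [set x; y; z].
    by rewrite -Ez; apply/setP=> h; rewrite in_setU in_setD;
      case: (boolP (h \in [set x; y])) => // /(subsetP sND)->.
  have uD : uniq [:: x; y; z].
    by move: zN; rewrite /= !inE !negb_or xy ![z == _]eq_sym => /andP[-> ->].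
  exists z; split; first exact: goodI.
  - by rewrite /tau nv cards2 xy.
  - by rewrite !inv ?(subsetP DS) // !inE !eqxx orbT.
  - exact: t2.
  split; first by exists u0.
  (* [u] is outside the new set, being distinct from [w], which unlike [u] is adjacent to [z]. Its
     dominator there is not [v], nor a surviving solution vertex, since the solution neighbours of
     [u] are among [x] and [y]. Only [w] remains. *)
  move=> u exu /and3P[uv neuv /forall_inP wu].
  have uS : u \notin S by rewrite sS negbK; apply/dominatedP; exists x;
    rewrite 1?eC // (subsetP DS).
  have uw : u != w.
    by apply/eqP=> E; have := wu z zS; rewrite E ewz (negPf zN).
  have : u \notin S' by rewrite inS' (negPf uS) EA !inE /= negb_or uv.
  rewrite sS' negbK => /dominatedP[h];
    rewrite inS' EA => /orP[/andP[hS hD]|/set2P[]->] // euh.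
    by case/negP: hD; apply: (subsetP sND); have := wu h hS; rewrite euh.
  by rewrite euh in neuv.
suff [v [w [EA tv]]] : exists v w, A = [set v; w] /\ tau e S v = 2.
  have [x [y [xy nv]]] := cards2P _ (introT eqP tv).
  have vS : v \notin S by apply: disjA; rewrite EA set21.
  have [u0 u0S wu0] := minimal2_wit solS m2 vS xy nv.
  move: u0S; rewrite sS negbK => /dominatedP[h hS eu0h].
  have /and3P[_ _ /forall_inP/(_ h hS)] := wu0; rewrite eu0h => /set2P[] Eh.
    rewrite Eh eC in eu0h.
    by have [z H] := base v w x y u0 EA xy nv eu0h wu0; exists v, w, x, y, z;
      right.
  rewrite Eh eC in eu0h; rewrite eq_sym in xy; rewrite setUC in nv.
  have wu0' : witness S v y x u0 by rewrite /witness setUC.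
  by have [z H] := base v w y x u0 EA xy nv eu0h wu0'; exists v, w, y, x, z;
    right.
(* Both inserted vertices are at most 2-tight here, yet together they must cover the three removed
   ones, so one of them is exactly 2-tight. *)
have cover v w : A = [set v; w] -> 3 <= tau e S v + tau e S w.
  move=> EA; rewrite -cD; apply: leq_trans (leq_card_setU _ _).
  apply/subset_leq_card/subsetP=> h hD.
  have [a] := domD h hD; rewrite EA !inE (subsetP DS h hD) !andbT.
  by case/orP=> /eqP-> ->; rewrite ?orbT.
have tA v w : A = [set v; w] -> tau e S v <= 2 /\ tau e S w <= 2.
  by move=> EA; rewrite !t2 // EA ?set21 ?set22.
have [v [w EA]] : exists v w, A = [set v; w].
  by have /set0Pn[v vA] := A0; exists v; exact: card_le2.
have := cover v w EA; have [] := tA v w EA.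
case: (ltngtP (tau e S v) 2) => // [tv _ tw ge3|tv _ _ _]; last by exists v, w.
by exists w, v; split; [rewrite setUC|lia].
Qed.

End Solutions.

(* Vertex registers: 6 holds v, 8 x, 9 y, 10 the witness u, 11 w and 12 z; a
   cursor has the number of the vertex register it feeds. Vertex registers
   1 to 5 hold the last good (v, w, x, y, z) found, and integer register 0
   tells whether there is one. Integer registers 15, 16 and 17 are flags. *)
Definition each_adj (p a : nat) (c : cmd) : cmd :=
  Seq (Do (PAdj p a))
      (While (TNot (TNil p)) (Seq (Do (VHead p p)) (Seq c (Do (PNext p))))).

Definition each_sol (p a : nat) (c : cmd) : cmd :=
  each_adj p a (If (TIn p) c Skip).

Definition each_section (s : section) (c : cmd) : cmd :=
  Seq (Do (ISize 7 s)) (Seq (Do (IConst 6 0))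
      (While (TLtI 6 7) (Seq (Do (VNth 6 s 6)) (Seq c (Do (IInc 6)))))).

(** * A timed program logic *)

Section Logic.

Variables (T : finType) (e : rel T) (adj : T -> seq T).
Implicit Types (st : state T) (A : pred nat) (P : Prop) (B : nat) (c : cmd).

(** Total correctness with a time bound; exhibiting one halting run is enough because execution is
    deterministic. *)
Definition wp c B (Q : state T -> Prop) st : Prop :=
  exists t st', [/\ exec e adj c st t st', t <= B & Q st'].

Lemma wp_weaken c B B' (Q Q' : state T -> Prop) st :
  wp c B Q st -> B <= B' -> (forall st', Q st' -> Q' st') -> wp c B' Q' st.
Proof.
by move=> [t [st' [E le Qs]]] leB QQ; exists t, st'; split; eauto; lia.
Qed.

Lemma wp_le c B B' (Q : state T -> Prop) st :
  wp c B Q st -> B <= B' -> wp c B' Q st.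
Proof. by move=> H leB; apply: wp_weaken H leB _. Qed.

Lemma wp_skip (Q : state T -> Prop) st : Q st -> wp Skip 0 Q st.
Proof. by exists 0, st; split=> //; constructor. Qed.

Lemma wp_do a st' (Q : state T -> Prop) st :
  run_instr e adj a st = Some st' -> Q st' -> wp (Do a) (cost e a st) Q st.
Proof. by move=> E Qs; exists (cost e a st), st'; split=> //; constructor. Qed.

Lemma wp_seq c1 c2 B1 B2 (Q : state T -> Prop) st :
  wp c1 B1 (wp c2 B2 Q) st -> wp (Seq c1 c2) (B1 + B2) Q st.
Proof.
move=> [t1 [st1 [E1 l1 [t2 [st2 [E2 l2 Qs]]]]]].
by exists (t1 + t2), st2; split=> //; [exact: ExecSeq E1 E2 | lia].
Qed.

Lemma wp_if b r c1 c2 B (Q : state T -> Prop) st :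
  run_test b st = Some r -> wp (if r then c1 else c2) B Q st ->
  wp (If b c1 c2) B.+1 Q st.
Proof.
by move=> E [t [st' [X l Qs]]]; exists t.+1, st'; split=> //; exact: ExecIf E X.
Qed.

(** A frame condition. One predicate on numbers covers all three kinds of registers; the solution
    and its ordering are always kept, so section lists stay valid throughout a loop. *)
Definition agree A st st' : Prop :=
  [/\ sol st' = sol st, ord st' = ord st &
      forall r, A r -> [/\ vreg st' r = vreg st r, ireg st' r = ireg st r
                         & preg st' r = preg st r]].

Lemma agree_refl A st : agree A st st. Proof. by []. Qed.

Lemma agree_trans A st1 st2 st3 :
  agree A st1 st2 -> agree A st2 st3 -> agree A st1 st3.
Proof.
move=> [s1 o1 r1] [s2 o2 r2]; split; [congruence|congruence|move=> r Ar].
by have [? ? ?] := r1 r Ar; have [? ? ?] := r2 r Ar; split; congruence.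
Qed.

Lemma agree_sub A A' st st' :
  agree A st st' -> (forall r, A' r -> A r) -> agree A' st st'.
Proof. by move=> [? ? H] sA; split=> // r /sA; apply: H. Qed.

Lemma agree_vreg A st r x : ~~ A r -> agree A st (set_vreg st r x).
Proof. by move=> nA; split=> // q Aq /=; case: eqP => // E;
  rewrite -E Aq in nA. Qed.

Lemma agree_ireg A st r m : ~~ A r -> agree A st (set_ireg st r m).
Proof. by move=> nA; split=> // q Aq /=; case: eqP => // E;
  rewrite -E Aq in nA. Qed.

Lemma agree_preg A st r l : ~~ A r -> agree A st (set_preg st r l).
Proof. by move=> nA; split=> // q Aq /=; case: eqP => // E;
  rewrite -E Aq in nA. Qed.

Lemma agreeV A st st' r x :
  agree A st st' -> vreg st r = Some x -> A r -> vreg st' r = Some x.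
Proof. by move=> [_ _ H] E /H[-> _ _]. Qed.

Lemma agree_section A st st' s :
  agree A st st' -> section_seq e st' s = section_seq e st s.
Proof. by case=> sE oE _; rewrite /section_seq sE oE. Qed.

(* Fnd is the success flag of a search and Ok an invariant recording what a
   raised flag entails; both are read off the registers in A0. *)
Section Search.

Variables (Ok Fnd : state T -> Prop) (A0 : pred nat).
Hypothesis resp : forall st st',
  agree A0 st st' -> (Ok st -> Ok st') /\ (Fnd st -> Fnd st').

(** Completeness is one-directional: [P] forces the flag up, and soundness is left to [Ok]. As a
    raised flag stays up, sequencing becomes a disjunction of goals and a loop an existential. *)
Definition search A B P c st : Prop :=
  wp c B (fun st' => [/\ agree A st st', Ok st -> Ok st'
                       & Fnd st \/ P -> Fnd st']) st.

Lemma search_weaken A A' B B' P P' c st :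
  search A B P c st -> B <= B' -> (forall r, A' r -> A r) -> (P' -> P) ->
  search A' B' P' c st.
Proof.
move=> H leB sA PP; apply: wp_weaken H leB _ => st' [? ? HF].
by split=> //; [exact: agree_sub sA|case=> [F|/PP p]; apply: HF; auto].
Qed.

Lemma search_imp A B B' P P' c st :
  search A B P c st -> B <= B' -> (P' -> P) -> search A B' P' c st.
Proof. by move=> H leB PP; apply: search_weaken H leB _ PP. Qed.

Lemma search_le A B B' P c st :
  search A B P c st -> B <= B' -> search A B' P c st.
Proof. by move=> H leB; apply: search_imp H leB _. Qed.

Lemma search_skip A P st : ~ P -> search A 0 P Skip st.
Proof. by move=> nP; apply: wp_skip; split=> //; case. Qed.

Lemma search_if A b r c1 c2 B P st :
  run_test b st = Some r -> search A B P (if r then c1 else c2) st ->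
  search A B.+1 P (If b c1 c2) st.
Proof. by move=> E H; exact: wp_if E H. Qed.

Lemma search_seq A B1 B2 P1 P2 c1 c2 st :
  search A B1 P1 c1 st ->
  (forall st1, agree A st st1 -> search A B2 P2 c2 st1) ->
  search A (B1 + B2) (P1 \/ P2) (Seq c1 c2) st.
Proof.
move=> H1 H2; apply/wp_seq/(wp_weaken H1 (leqnn _)) => st1 [a1 o1 f1].
apply: wp_weaken (H2 st1 a1) (leqnn _) _ => st2 [a2 o2 f2].
split; [exact: agree_trans a1 a2|by auto|].
by case=> [F|[p|p]]; apply: f2; auto.
Qed.

(** The first command is a subroutine that leaves the flag and its data alone; the goal is met by
    the second, which may use what the subroutine established. *)
Lemma search_call A B1 B2 P c1 c2 st :
  wp c1 B1 (fun st1 => [/\ agree A st st1, agree A0 st st1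
                         & search A B2 P c2 st1]) st ->
  search A (B1 + B2) P (Seq c1 c2) st.
Proof.
move=> H1; apply/wp_seq/(wp_weaken H1 (leqnn _)) => st1 [a1 /resp[o1 f1] H2].
apply: wp_weaken H2 (leqnn _) _ => st2 [a2 o2 f2].
split; [exact: agree_trans a1 a2|by auto|].
by case=> [F|p]; apply: f2; auto.
Qed.

Lemma search_do A a st1 B P c st :
  run_instr e adj a st = Some st1 -> cost e a st = 1 -> agree A st st1 ->
  agree A0 st st1 -> search A B P c st1 ->
  search A B.+1 P (Seq (Do a) c) st.
Proof.
move=> E C1 a1 a2 H; rewrite -add1n -C1; apply: search_call.
by apply: wp_do E _.
Qed.

(** The cost [f] depends on the entry so that cheap entries are not charged for the worst case. The
    3 pays for the loop test and for reading and advancing the cursor, the 2 for loading the list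
    and the final test. *)
Lemma search_each_adj A p a v (f : T -> nat) (P : T -> Prop) c st :
  ~~ A0 p -> ~~ A p -> vreg st a = Some v ->
  (forall x st1, x \in adj v -> agree A st st1 -> vreg st1 p = Some x ->
     search (predU1 p A) (f x) (P x) c st1) ->
  search A (2 + \sum_(x <- adj v) (f x + 3)) (exists2 x, x \in adj v & P x)
         (each_adj p a c) st.
Proof.
move=> nA0 nA Ea H; rewrite -[2 + _]/((1 + _).+1).
apply: (search_do (st1 := set_preg st p (adj v)));
  [by rewrite /= Ea|by []|exact: agree_preg|exact: agree_preg|].
set st1 := set_preg _ _ _.
have : preg st1 p = adj v by rewrite /= eqxx.
have : agree A st st1 by exact: agree_preg.
have : {subset adj v <= adj v} by [].
(* The induction runs over the suffix still held by the cursor; of its entries only membership in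
   [adj v] is remembered. *)
move: {1 3 4 5}(adj v) => l; move: st1.
elim: l => [|x l IH] st1 sl ag Ep.
  exists 1, st1; rewrite big_nil; split=> //.
    by apply: ExecWhileF; rewrite /= Ep.
  by split=> //; case=> // -[].
have ag2 := @agree_vreg A st1 p x nA; set st2 := set_vreg _ _ _ in ag2.
have Ex : vreg st2 p = Some x by rewrite /= eqxx.
have xl : x \in adj v by apply: sl; exact: mem_head.
have [t [st3 [E3 l3 [ag3 o3 f3]]]] := H x st2 xl (agree_trans ag ag2) Ex.
have Ep3 : preg st3 p = x :: l.
  by case: ag3 => _ _ /(_ p); rewrite /= eqxx => /(_ isT)[_ _ ->].
have ag3' : agree A st2 st3 by apply: agree_sub ag3 _ => r /= ->; rewrite orbT.
pose st4 := set_preg st3 p l.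
have ag4 : agree A st3 st4 by exact: agree_preg.
have ag14 := agree_trans ag2 (agree_trans ag3' ag4).
have [|||t5 [st5 [E5 l5 [ag5 o5 f5]]]] := IH st4.
- by move=> u ul; apply: sl; rewrite inE ul orbT.
- exact: agree_trans ag ag14.
- by rewrite /= eqxx.
exists (1 + (t + 1) + t5).+1, st5; split.
- apply: ExecWhileT E5; first by rewrite /= Ep.
  apply: ExecSeq; first by apply: (@ExecDo _ _ _ (VHead p p)); rewrite /= Ep.
  apply: ExecSeq E3 _; apply: (@ExecDo _ _ _ (PNext p)).
  by rewrite /= Ep3 /=.
- by rewrite big_cons; lia.
have [o12 f12] := resp (@agree_vreg A0 st1 p x nA0).
have [o34 f34] := resp (@agree_preg A0 st3 p l nA0).
split; [exact: agree_trans ag14 ag5|by move=> ok1; auto|].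
case=> [F|[u]]; first by apply: f5; left; apply: f34; auto.
rewrite inE => /predU1P[->|ul] Pu; first by apply: f5; left; auto.
by apply: f5; right; exists u.
Qed.

Lemma search_each_section s B (P : T -> Prop) c st :
  ~~ A0 6 -> ~~ A0 7 ->
  (forall v st1, v \in section_seq e st s -> agree pred0 st st1 ->
     vreg st1 6 = Some v -> search (pred2 6 7) B (P v) c st1) ->
  search pred0 (3 + size (section_seq e st s) * (B + 3))
         (exists2 v, v \in section_seq e st s & P v) (each_section s c) st.
Proof.
move=> n6 n7 H; set l := section_seq e st s.
rewrite -[3 + _]/((1 + _).+2).
apply: search_do; [by []|by []|exact: agree_ireg|exact: agree_ireg|].
apply: search_do; [by []|by []|exact: agree_ireg|exact: agree_ireg|].
(* [m] counts the rounds left, and the index in register 6 marks the suffix still to be searched. *)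
suff loop m st0 : ireg st0 6 + m = size l -> ireg st0 7 = size l ->
    agree pred0 st st0 ->
    search pred0 (1 + m * (B + 3))
      (exists2 v, v \in drop (ireg st0 6) l & P v)
      (While (TLtI 6 7) (Seq (Do (VNth 6 s 6)) (Seq c (Do (IInc 6))))) st0.
  apply: (search_weaken (loop (size l) _ _ _ _)) => //=.
  by rewrite drop0.
elim: m st0 => [|m IH] st0 E6 E7 ag.
  exists 1, st0; split=> //.
    by apply: ExecWhileF; rewrite /= E7 -E6 addn0 ltnn.
  by split=> //; case=> // -[v]; rewrite drop_oversize // -E6 addn0.
have lt6 : ireg st0 6 < size l by lia.
case El: l => [|v0 l0]; first by rewrite El in lt6.
rewrite -El; pose v := nth v0 l (ireg st0 6); pose st2 := set_vreg st0 6 v.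
have vl : v \in l by exact: mem_nth.
have ag2 : agree pred0 st st2 by case: ag => ? ? _; split.
have [t [st3 [E3 l3 [ag3 o3 f3]]]] := H v st2 vl ag2 erefl.
have i36 : ireg st3 6 = ireg st0 6 by case: ag3 => _ _ /(_ 6 isT)[_ ->].
have i37 : ireg st3 7 = ireg st0 7 by case: ag3 => _ _ /(_ 7 isT)[_ ->].
pose st4 := set_ireg st3 6 (ireg st3 6).+1.
have ag4 : agree pred0 st0 st4.
  by case: ag3 => [sE oE _]; split.
have [|||t5 [st5 [E5 l5 [ag5 o5 f5]]]] := IH st4.
- by rewrite /= i36; lia.
- by rewrite /= i37.
- exact: agree_trans ag ag4.
exists (1 + (t + 1) + t5).+1, st5; split.
- apply: ExecWhileT E5; first by rewrite /= E7 lt6.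
  apply: ExecSeq.
    apply: (@ExecDo _ _ _ (VNth 6 s 6) _ st2).
    by rewrite /= (agree_section s ag) -/l onthE (nth_map v0).
  by apply: ExecSeq E3 _; apply: (@ExecDo _ _ _ (IInc 6)).
- lia.
have [o12 f12] := resp (@agree_vreg A0 st0 6 v n6).
have [o34 f34] := resp (@agree_ireg A0 st3 6 (ireg st3 6).+1 n6).
split; [exact: agree_trans ag4 ag5|by auto|].
case=> [F|[u]]; first by apply: f5; left; apply: f34; auto.
rewrite (drop_nth v0) // inE => /predU1P[->|ul] Pu; first by apply: f5; left;
  auto.
by apply: f5; right; exists u; rewrite //= i36.
Qed.

End Search.
End Logic.

(** * The search program *)

Definition test_new (r : nat) (c1 c2 : cmd) : cmd :=
  If (TEqV r 6) c1 (If (TEqV r 11) c1 (If (TIn r)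
    (If (TEqV r 8) c2 (If (TEqV r 9) c2 (If (TEqV r 12) c2 c1))) c2)).

Definition test_dominated (r : nat) : cmd :=
  Seq (Do (IConst 15 0))
      (each_adj 14 r (test_new 14 (Do (IConst 15 1)) Skip)).

(** Flag 15 records domination by the new set, flag 17 membership in it. They differ at every vertex
    of the graph when the new set is a solution, so equality raises the failure flag 16. *)
Definition test_vertex (r : nat) : cmd :=
  Seq (test_dominated r)
      (Seq (test_new r (Do (IConst 17 1)) (Do (IConst 17 0)))
           (If (TEqI 15 17) (Do (IConst 16 1)) Skip)).

Definition test_ball (r : nat) : cmd :=
  Seq (test_vertex r) (each_adj 13 r (test_vertex 13)).

Definition fail_if (b : test) : cmd := If b (Do (IConst 16 1)) Skip.

(** The calling loops guarantee that [v] is outside the solution and [x, y, z] inside it, but not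
    that [x, y, z] are distinct; repetitions are rejected here. *)
Definition test_swap : cmd :=
  Seq (Do (IConst 16 0))
 (Seq (test_ball 8) (Seq (test_ball 9) (Seq (test_ball 12)
 (Seq (fail_if (TEqV 8 9)) (Seq (fail_if (TEqV 8 12))
 (Seq (fail_if (TEqV 9 12)) (fail_if (TIn 11)))))))).

Definition save_swap : cmd :=
  Seq (Do (VCopy 1 6)) (Seq (Do (VCopy 2 11)) (Seq (Do (VCopy 3 8))
 (Seq (Do (VCopy 4 9)) (Seq (Do (VCopy 5 12)) (Do (IConst 0 1)))))).

Definition check_swap : cmd :=
  Seq test_swap (Seq (Do (IConst 15 0)) (If (TEqI 16 15) save_swap Skip)).

Definition test_witness : cmd :=
  Seq (Do (IConst 16 0))
 (Seq (each_adj 14 13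
        (If (TEqV 14 6) (Do (IConst 16 1))
        (If (TIn 14) (If (TEqV 14 8) Skip
                     (If (TEqV 14 9) Skip (Do (IConst 16 1)))) Skip)))
      (fail_if (TEqV 13 6))).

Definition find_witness : cmd :=
  Seq (Do (IConst 10 0)) (each_adj 13 8 (Seq test_witness
    (Seq (Do (IConst 15 0))
         (If (TEqI 16 15) (Seq (Do (VCopy 10 13)) (Do (IConst 10 1)))
             Skip)))).

(** [SecT3up] also holds vertices of tightness above 3, which no 3-swap can insert; filtering them
    out limits each loop over solution neighbours to three rounds. *)
Definition search3 : cmd :=
  Seq (Do (ITau 8 6)) (Seq (Do (IConst 9 3)) (If (TEqI 8 9)
    (each_sol 8 6 (each_sol 9 6 (each_adj 11 8 (each_sol 12 6 check_swap))))
    Skip)).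

(** Both orders of the two solution neighbours of [v] are tried, since the witness is sought around
    the first only. Membership of [w] is tested before its tightness, which is undefined on solution
    vertices. *)
Definition search2 : cmd :=
  each_sol 8 6 (each_sol 9 6 (Seq find_witness
    (Seq (Do (IConst 11 1)) (If (TEqI 10 11)
      (each_adj 11 10 (If (TIn 11) Skip
        (Seq (Do (ITau 13 11)) (Seq (Do (IConst 14 3))
          (If (TLtI 13 14) (each_sol 12 11 check_swap) Skip)))))
      Skip)))).

Definition perform_swap : cmd :=
  Seq (Do (SDrop 3)) (Seq (Do (SDrop 4)) (Seq (Do (SDrop 5))
    (Seq (Do (SAdd 1)) (If (TEqV 1 2) Skip (Do (SAdd 2)))))).

Definition three_swap_search : cmd :=
  Seq (Do (IConst 0 0)) (Seq (each_section SecT3up search3)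
    (Seq (each_section SecT2 search2)
      (Seq (Do (IConst 6 1)) (If (TEqI 0 6) perform_swap Skip)))).

(** Powers of Delta + 1 absorb all lower-order terms, even when Delta is 0. *)
Lemma leq_succ_powers (d : nat) :
  [/\ d <= d.+1, d.+1 <= d.+1 * d.+1 & d.+1 * d.+1 <= d.+1 * d.+1 * d.+1].
Proof. by split=> //; nia. Qed.

(** * Cost of loops over neighbourhoods *)

Section Algorithm.

Variables (T : finType) (e : rel T) (adj : T -> seq T) (S : {set T}).
Hypotheses (Ge : simple_graph e) (adjP : adjacency_lists e adj).
Hypothesis solS : solution e S.
Implicit Types (st : state T) (A : pred nat) (P Q : Prop) (B : nat) (c : cmd).

Local Notation d := (max_degree e).
Local Notation wp := (wp e adj).
Local Notation search := (search e adj).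

Lemma mem_adj v u : (u \in adj v) = e v u.
Proof. by case: (adjP v). Qed.

Lemma deg_max v : deg e v <= d.
Proof. exact: leq_bigmax. Qed.

Lemma size_adj v : size (adj v) <= d.
Proof.
apply: leq_trans (deg_max v); rewrite /deg.
have [u _] := adjP v; rewrite -(card_uniqP u).
by apply/subset_leq_card/subsetP=> h; rewrite mem_adj inE.
Qed.

Lemma count_adj v : count (mem S) (adj v) = tau e S v.
Proof.
have [u _] := adjP v; rewrite -size_filter -(card_uniqP (filter_uniq _ u)).
by apply: eq_card => h; rewrite mem_filter mem_adj !inE andbC.
Qed.

Lemma sum_adj_const v (f : T -> nat) B :
  (forall x, x \in adj v -> f x <= B) -> \sum_(x <- adj v) f x <= d * B.
Proof.
move=> H; apply: (@leq_trans (\sum_(x <- adj v) B)).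
  by rewrite big_seq [X in _ <= X]big_seq; apply: leq_sum.
by rewrite big_const_seq count_predT iter_addn_0 mulnC leq_mul2r size_adj orbT.
Qed.

Section Loops.

Variables (Ok Fnd : state T -> Prop) (A0 : pred nat).
Hypothesis resp : forall st st',
  agree A0 st st' -> (Ok st -> Ok st') /\ (Fnd st -> Fnd st').

Lemma search_each_adj_const A p a v B (P : T -> Prop) c st :
  ~~ A0 p -> ~~ A p -> vreg st a = Some v ->
  (forall x st1, e v x -> agree A st st1 -> vreg st1 p = Some x ->
     search Ok Fnd (predU1 p A) B (P x) c st1) ->
  search Ok Fnd A (2 + d * (B + 3)) (exists2 x, e v x & P x)
         (each_adj p a c) st.
Proof.
move=> n0 nA Ea H.
apply: (search_weaken (search_each_adj resp (f := fun=> B) (P := P) n0 nA Ea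
  _)).
- by move=> x st1; rewrite mem_adj; apply: H.
- by rewrite leq_add2l; apply: sum_adj_const.
- by [].
- by case=> x; rewrite -mem_adj; exists x.
Qed.

(** Each entry costs four units besides the body, and the body runs only at solution neighbours;
    hence the degree enters additively, with [2 + 4 * d] rounded up to [6 * d.+1]. *)
Lemma search_each_sol A p a v B t (P : T -> Prop) c st :
  ~~ A0 p -> ~~ A p -> vreg st a = Some v -> sol st = S -> tau e S v <= t ->
  (forall x st1, x \in S -> e v x -> agree A st st1 -> vreg st1 p = Some x ->
     search Ok Fnd (predU1 p A) B (P x) c st1) ->
  search Ok Fnd A (6 * d.+1 + t * B) (exists2 x, (x \in S) && e v x & P x)
         (each_sol p a c) st.
Proof.
move=> n0 nA Ea sE tv H.
apply: (search_weaken (search_each_adj resp (f := fun x => 1 + (x \in S) * B)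
   (P := fun x => x \in S /\ P x) n0 nA Ea _)).
- move=> x st1; rewrite mem_adj => evx ag Ep.
  have sE1 : sol st1 = S by case: ag => ->.
  apply: (@search_if _ _ _ _ _ _ _ (x \in S)); first by rewrite /= Ep /= sE1.
  case: (boolP (x \in S)) => xS; rewrite ?mul1n ?mul0n.
    by apply: (search_weaken (H x st1 xS evx ag Ep)) => // -[].
  by apply: search_skip => -[].
- rewrite (eq_bigr (fun x => 4 + (x \in S) * B)); last by move=> x _; lia.
  rewrite big_split /= -big_distrl /=.
  have -> : \sum_(x <- adj v) (x \in S) = tau e S v.
    by rewrite -count_adj -sum1_count [RHS]big_mkcond; apply: eq_bigr => x _;
      case: ifP => /= ->.
  have := @sum_adj_const v (fun=> 4) 4 (fun _ _ => leqnn _).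
  have : tau e S v * B <= t * B by rewrite leq_mul2r tv orbT.
  lia.
- by [].
- by case=> x /andP[xS evx] Px; exists x; rewrite ?mem_adj.
Qed.

End Loops.

Definition flag r Q st := ireg st r = 0 \/ (ireg st r = 1 /\ Q).

Lemma flag_resp r Q st st' :
  agree (pred1 r) st st' ->
  (flag r Q st -> flag r Q st') /\ (ireg st r = 1 -> ireg st' r = 1).
Proof.
by case=> _ _ /(_ r); rewrite /= eqxx => /(_ isT)[_ E _]; rewrite /flag E.
Qed.

(** A flag that starts at 0, entails [Q] when it is 1, and is forced to 1 by [Q] computes the truth
    value of [Q] exactly. *)
Lemma wp_flag r Q (b : bool) A B c st :
  reflect Q b -> ireg st r = 0 ->
  search (flag r Q) (fun s => ireg s r = 1) A B Q c st ->
  wp c B (fun st' => agree A st st' /\ ireg st' r = b) st.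
Proof.
move=> rQ E0 H; apply: wp_weaken H (leqnn _) _ => st' [ag ok fnd].
split=> //; case: rQ fnd ok => [q|nq] fnd ok; first by apply: fnd; right.
by case: (ok (or_introl E0)) => // -[_ /nq].
Qed.

Lemma search_raise r Q P A (b : bool) st :
  ~~ A r -> (b -> Q) -> (P -> b) ->
  search (flag r Q) (fun s => ireg s r = 1) A 1 P
    (if b then Do (IConst r 1) else Skip) st.
Proof.
move=> nA; case: b => bQ Pb.
  apply: (wp_do (a := IConst r 1)); first by [].
  split; first exact: agree_ireg.
    by right; rewrite /= eqxx; split=> //; exact: bQ.
  by rewrite /= eqxx.
by apply: (search_weaken (@search_skip _ _ _ _ _ A P st _)) => // /Pb.
Qed.

(** * Checking one candidate swap *)

Section Check.

Variables (v w x y z : T).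
Hypotheses (vS : v \notin S) (sxyz : all (mem S) [:: x; y; z]).

Local Notation S' := (swapped S v w x y z).

Definition regs st :=
  [/\ sol st = S, vreg st 6 = Some v, vreg st 8 = Some x, vreg st 9 = Some y
    & vreg st 11 = Some w /\ vreg st 12 = Some z].

Lemma regs_agree A st st' :
  agree A st st' -> all A [:: 6; 8; 9; 11; 12] -> regs st -> regs st'.
Proof.
move=> ag /= /and5P[A6 A8 A9 A11 /andP[A12 _]] [sE ? ? ? [? ?]].
split; [by case: ag => ->|..|split]; exact: agreeV ag _ _.
Qed.

(** Six is the number of nested tests; no update of the solution, with its cost proportional to a
    degree, is involved. *)
Lemma wp_test_new r u c1 c2 B (Q : state T -> Prop) st :
  regs st -> vreg st r = Some u -> wp (if u \in S' then c1 else c2) B Q st ->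
  wp (test_new r c1 c2) (6 + B) Q st.
Proof.
move=> [sE Ev Ex Ey [Ew Ez]] Er; rewrite in_swapped.
have lift c k : wp c B Q st -> wp c (k + B) Q st.
  by move=> H; apply: wp_weaken H (leq_addl _ _) _.
move=> H; apply: (@wp_if _ _ _ _ (u == v)); first by rewrite /= Er Ev.
case: (u == v) H => /= H; first exact: (lift _ 5).
apply: (@wp_if _ _ _ _ (u == w)); first by rewrite /= Er Ew.
case: (u == w) H => /= H; first exact: (lift _ 4).
apply: (@wp_if _ _ _ _ (u \in S)); first by rewrite /= Er /= sE.
case: (u \in S) H => /= H; last exact: (lift _ 3).
apply: (@wp_if _ _ _ _ (u == x)); first by rewrite /= Er Ex.
case: (u == x) H => /= H; first exact: (lift _ 2).
apply: (@wp_if _ _ _ _ (u == y)); first by rewrite /= Er Ey.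
case: (u == y) H => /= H; first exact: (lift _ 1).
apply: (@wp_if _ _ _ _ (u == z)); first by rewrite /= Er Ez.
by case: (u == z) H.
Qed.

(** Register 16 is framed along with the low registers because it carries the failure flag of the
    enclosing check. *)
Lemma wp_test_dominated r u st :
  regs st -> vreg st r = Some u -> r < 14 ->
  wp (test_dominated r) (12 * d.+1)
     (fun st1 => agree (fun q => (q < 14) || (q == 16)) st st1
                 /\ ireg st1 15 = dominated e S' u) st.
Proof.
move=> rst Er lr; pose A : pred nat := fun q => (q < 14) || (q == 16).
apply: (@wp_le _ _ _ _ (1 + (2 + d * (7 + 3)))).
  apply: wp_seq; apply: (wp_do (a := IConst 15 0)); first by [].
  set st1 := set_ireg _ _ _.
  have ag1 : agree A st st1 by exact: agree_ireg.
  have rst1 : regs st1 by exact: regs_agree ag1 _ rst.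
  have Er1 : vreg st1 r = Some u by exact: Er.
  apply: wp_weaken (wp_flag (r := 15) (Q := dominated e S' u) (A := A) idP _ _)
    (leqnn _) _ => //; last first.
    by move=> st2 [ag2 E2]; split=> //; exact: agree_trans ag1 ag2.
  apply: search_imp.
  - apply: (search_each_adj_const (@flag_resp 15 (dominated e S' u)) (p := 14)
      (B := 7)
      (P := fun h => h \in S') _ _ Er1) => //.
    move=> h st2 euh ag2 Eh.
    apply: (wp_test_new (B := 1) (u := h)) => //;
      first exact: regs_agree ag2 _ rst1.
    apply: search_raise => //.
    by move=> hS'; apply/dominatedP; exists h.
  - by [].
  - by case/dominatedP=> h; exists h.
by lia.
Qed.

Lemma search_test_vertex Q r u st :
  ((u \in S') = dominated e S' u -> Q) ->
  regs st -> vreg st r = Some u -> r < 14 ->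
  search (flag 16 Q) (fun s => ireg s 16 = 1) (fun q => q < 14)
    (21 * d.+1) ((u \in S') = dominated e S' u) (test_vertex r) st.
Proof.
move=> imp rst Er lr; pose A : pred nat := fun q => q < 14.
apply: (@search_le _ _ _ _ _ A (12 * d.+1 + (6 + 1 + 2))); last lia.
apply: (search_call (@flag_resp 16 Q)).
apply: wp_weaken (wp_test_dominated rst Er lr) (leqnn _) _ => st1 [ag1 E15].
have ag1' : agree A st st1 by apply: agree_sub ag1 _ => q Aq; apply/orP; left.
split=> //; first by apply: agree_sub ag1 _ => q /eqP->.
have rst1 : regs st1 by exact: regs_agree ag1' _ rst.
apply: (search_call (@flag_resp 16 Q)).
apply: (wp_test_new rst1 (agreeV ag1' Er lr)).
apply: (@wp_weaken _ _ _ _ 1 _ (fun st2 => [/\ agree A st1 st2, agree (pred1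
  16) st1 st2,
   ireg st2 15 = ireg st1 15 & ireg st2 17 = (u \in S')])) => //.
  case: (u \in S').
    by apply: (wp_do (a := IConst 17 1)); [by []|split=> //; exact: agree_ireg].
  by apply: (wp_do (a := IConst 17 0)); [by []|split=> //; exact: agree_ireg].
move=> st2 [ag2 ag2' E15' E17]; split=> //.
apply: (@search_if _ _ _ _ _ _ _ ((u \in S') == dominated e S' u)).
  by rewrite /= E15' E15 E17 eq_sym; case: (u \in S'); case: dominated.
by apply: search_raise => // E; [apply: imp; apply/eqP|apply/eqP].
Qed.

Lemma search_test_ball Q r u st :
  (forall h, (h \in S') = dominated e S' h -> Q) ->
  regs st -> vreg st r = Some u -> r < 13 ->
  search (flag 16 Q) (fun s => ireg s 16 = 1) (fun q => q < 13)
    (47 * (d.+1 * d.+1))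
    (exists2 h, h = u \/ e u h & (h \in S') = dominated e S' h)
    (test_ball r) st.
Proof.
move=> imp rst Er lr; have [d1 d2 _] := leq_succ_powers d.
apply: search_imp.
- apply: search_seq.
    apply: (@search_weaken _ _ _ _ _ _ (fun q => q < 13) _ _ _ _ _ _
             (search_test_vertex (Q := Q) (u := u) _ rst Er _)).
    + exact: imp.
    + exact: leq_trans lr _.
    + exact: leqnn.
    + by move=> q /= /leq_trans->.
    + exact: id.
  move=> st1 ag1.
  apply: (search_each_adj_const (@flag_resp 16 Q)) => //.
    exact: agreeV ag1 Er _.
  move=> h st2 euh ag2 Eh.
  apply: (@search_weaken _ _ _ _ _ _ _ _ _ _ _ _ _
             (search_test_vertex (Q := Q) (r := 13) (u := h) _ _ Eh _)) => //.
  + exact: imp.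
  + exact: regs_agree ag2 _ (regs_agree ag1 _ rst).
  + by move=> q /=; clear; lia.
  + exact: id.
- have := leq_mul d1 (leqnn (21 * d.+1 + 3)); lia.
- by case=> h [->|euh] E; [left|right; exists h].
Qed.

Lemma search_fail_if Q A b (r : bool) st :
  ~~ A 16 -> run_test b st = Some r -> (r -> Q) ->
  search (flag 16 Q) (fun s => ireg s 16 = 1) A 2 r (fail_if b) st.
Proof. by move=> nA E rQ; apply: search_if E _; apply: search_raise. Qed.

Lemma wp_test_swap st :
  regs st -> e x v -> e x w || e z w ->
  wp test_swap (150 * (d.+1 * d.+1))
     (fun st1 => agree (fun q => q < 13) st st1
                 /\ ireg st1 16 = ~~ good e S v w x y z) st.
Proof.
move=> rst exv exzw; pose A : pred nat := fun q => q < 13;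
  set g := good _ _ _ _ _ _ _.
have [d1 d2 _] := leq_succ_powers d.
have bad h : (h \in S') = dominated e S' h -> ~~ g.
  move=> E; rewrite /g /good;
    apply/negP=> /and5P[_ _ _ _ /(solutionP Ge)/(_ h)].
  by rewrite E; case: dominated.
apply: (@wp_le _ _ _ _ (1 + (47 * (d.+1 * d.+1) + (47 * (d.+1 * d.+1) +
  (47 * (d.+1 * d.+1) + (2 + (2 + (2 + 2)))))))); last lia.
apply: wp_seq; apply: (wp_do (a := IConst 16 0)); first by [].
set st1 := set_ireg _ _ _.
have ag1 : agree A st st1 by exact: agree_ireg.
have rst1 : regs st1 by exact: regs_agree ag1 _ rst.
apply: wp_weaken (wp_flag (r := 16) (Q := ~~ g) (A := A) idP _ _) (leqnn _) _
  => //; last first.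
  by move=> st2 [ag2 E2]; split=> //; exact: agree_trans ag1 ag2.
have R st2 : agree A st1 st2 -> regs st2 by move=> ag;
  exact: regs_agree ag _ rst1.
have [_ _ E8 E9 [_ E12]] := rst1.
have next P1 P2 B1 B2 c1 c2 st2 : agree A st1 st2 ->
  search (flag 16 (~~ g)) (fun s => ireg s 16 = 1) A B1 P1 c1 st2 ->
  (forall st3, agree A st1 st3 ->
    search (flag 16 (~~ g)) (fun s => ireg s 16 = 1) A B2 P2 c2 st3) ->
  search (flag 16 (~~ g)) (fun s => ireg s 16 = 1) A (B1 + B2) (P1 \/ P2) (Seq
    c1 c2) st2.
  by move=> ag H1 H2; apply: search_seq H1 _ => st3 ag3; apply: H2;
    exact: agree_trans ag ag3.
apply: search_imp.
- apply: (next _ _ _ _ _ _ _ (agree_refl _ _));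
    first by apply: (search_test_ball bad rst1 E8).
  move=> st2 ag2; apply: (next _ _ _ _ _ _ _ ag2);
    first by apply: (search_test_ball bad (R _ ag2));
    first exact: agreeV ag2 E9 _.
  move=> st3 ag3; apply: (next _ _ _ _ _ _ _ ag3);
    first by apply: (search_test_ball bad (R _ ag3));
    first exact: agreeV ag3 E12 _.
  have ne (b : bool) : (b -> ~~ uniq [:: x; y; z]) -> b -> ~~ g.
    by move=> H /H; rewrite /g /good => /negPf->.
  move=> st4 ag4; apply: (next _ _ _ _ _ _ _ ag4).
    apply: (@search_fail_if _ _ _ (x == y)) => //.
      by have [_ _ /= -> -> _] := R _ ag4.
    by apply: ne => // /eqP->; rewrite /= inE eqxx.
  move=> st5 ag5; apply: (next _ _ _ _ _ _ _ ag5).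
    apply: (@search_fail_if _ _ _ (x == z)) => //.
      by have [_ _ /= -> _ [_ ->]] := R _ ag5.
    by apply: ne => // /eqP->; rewrite /= !inE eqxx orbT.
  move=> st6 ag6; apply: (next _ _ _ _ _ _ _ ag6).
    apply: (@search_fail_if _ _ _ (y == z)) => //.
      by have [_ _ /= _ -> [_ ->]] := R _ ag6.
    by apply: ne => // /eqP->; rewrite /= !inE eqxx /= andbF.
  move=> st7 ag7; apply: (@search_fail_if _ _ _ (w \in S)) => //.
    by have [/= -> _ _ _ [-> _]] := R _ ag7.
  by move=> wS; rewrite /g /good wS /= !andbF.
- by [].
(* It remains to see that every bad candidate is detected. Either one of the four cheap tests fails,
   or the new set is not a solution, and then [swapped_solution], contraposed, puts a violated
   equation in one of the three balls. *)
rewrite /g /good sxyz vS /= !inE negb_or.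
case: (boolP (x == y)) => [|xy]; first by auto 7.
case: (boolP (x == z)) => [|xz]; first by auto 7.
case: (boolP (y == z)) => [|yz]; first by auto 9.
case: (boolP (w \in S)) => [|wS]; first by auto 9.
move=> /= nsol.
have : ~~ all (fun r => [forall u, ((u == r) || e r u) ==> ((u \in S') !=
  dominated e S' u)]) [:: x; y; z].
  apply: contra nsol => /allP H; apply: swapped_solution => // r u rD ru.
  have /forallP/(_ u)/implyP := H r rD.
  by case: ru => [->|->]; rewrite ?eqxx ?orbT => /(_ isT); case: (_ \in _);
    case: dominated.
have P1 r : ~~ [forall u, ((u == r) || e r u) ==> ((u \in S') != dominated e S'
  u)] ->
  exists2 h, h = r \/ e r h & (h \in S') = dominated e S' h.
  rewrite negb_forall => /existsP[u];
    rewrite negb_imply negbK => /andP[ru /eqP E].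
  by exists u => //; case/orP: ru => [/eqP|]; auto.
by rewrite /= andbT !negb_and => /or3P[] /P1; auto.
Qed.

End Check.

(** * Searching around one vertex *)

Definition found st :=
  ireg st 0 = 0 \/ (ireg st 0 = 1 /\ exists v w x y z,
    [/\ good e S v w x y z, vreg st 1 = Some v, vreg st 2 = Some w,
        vreg st 3 = Some x & vreg st 4 = Some y /\ vreg st 5 = Some z]).

Local Notation main_search := (search found (fun s => ireg s 0 = 1)).

Lemma found_resp st st' :
  agree (fun q => q < 6) st st' ->
  (found st -> found st') /\ (ireg st 0 = 1 -> ireg st' 0 = 1).
Proof.
move=> ag; have [_ _ /(_ 0 isT)[_ E0 _]] := ag; rewrite /found E0; split=> //.
case=> [|[-> [v [w [x [y [z [g E1 E2 E3 [E4 E5]]]]]]]]]; first by left.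
right; split=> //; exists v, w, x, y, z; split=> //; [..|split];
  by apply: agreeV ag _ _.
Qed.

Lemma search_check_swap v w x y z st :
  v \notin S -> all (mem S) [:: x; y; z] -> e x v -> e x w || e z w ->
  regs v w x y z st ->
  main_search (fun q => (6 <= q) && (q < 13)) (160 * (d.+1 * d.+1))
    (good e S v w x y z) check_swap st.
Proof.
move=> vS sxyz exv exzw rst; have [d1 d2 _] := leq_succ_powers d.
apply: (@search_le _ _ _ _ _ _ (150 * (d.+1 * d.+1) + 8)); last lia.
apply: (search_call found_resp).
apply: wp_weaken (wp_test_swap vS sxyz rst exv exzw) (leqnn _) _ => st1 [ag1
  E16].
have ag1' : agree (fun q => (6 <= q) && (q < 13)) st st1.
  by apply: agree_sub ag1 _ => q /andP[].
split=> //; first by apply: agree_sub ag1 _ => q /leq_trans->.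
apply: (search_do found_resp (st1 := set_ireg st1 15 0)) => //.
- exact: agree_ireg.
- exact: agree_ireg.
apply: (@search_if _ _ _ _ _ _ _ (good e S v w x y z)).
  by rewrite /= E16; case: good.
have [_ E6 E8 E9 [E11 E12]] : regs v w x y z st1 by exact: regs_agree ag1' _
  rst.
case: ifP => [g|_]; last first.
  by apply: search_le; [apply: search_skip|].
pose st2 := set_ireg (set_vreg (set_vreg (set_vreg (set_vreg (set_vreg
  (set_ireg st1 15 0) 1 v) 2 w) 3 x) 4 y) 5 z) 0 1.
exists 6, st2; split=> //.
  apply: (ExecSeq (t1 := 1) (t2 := 5)).
    by apply: (@ExecDo _ _ _ (VCopy 1 6)); rewrite /= E6.
  apply: (ExecSeq (t1 := 1) (t2 := 4)).
    by apply: (@ExecDo _ _ _ (VCopy 2 11)); rewrite /= E11.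
  apply: (ExecSeq (t1 := 1) (t2 := 3)).
    by apply: (@ExecDo _ _ _ (VCopy 3 8)); rewrite /= E8.
  apply: (ExecSeq (t1 := 1) (t2 := 2)).
    by apply: (@ExecDo _ _ _ (VCopy 4 9)); rewrite /= E9.
  apply: (ExecSeq (t1 := 1) (t2 := 1)).
    by apply: (@ExecDo _ _ _ (VCopy 5 12)); rewrite /= E12.
  exact: (@ExecDo _ _ _ (IConst 0 1)).
split=> //.
  split=> // q /andP[q6 q13].
  by split=> //=; do !(case: eqP => [?|_]; first lia).
by move=> _; right; split=> //; exists v, w, x, y, z.
Qed.

Lemma wp_test_witness v x y u st :
  sol st = S -> vreg st 6 = Some v -> vreg st 8 = Some x ->
  vreg st 9 = Some y -> vreg st 13 = Some u ->
  wp test_witness (13 * d.+1)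
    (fun st1 => agree (fun q => q < 14) st st1
                /\ ireg st1 16 = ~~ witness e S v x y u) st.
Proof.
move=> sE Ev Ex Ey Eu; pose A : pred nat := fun q => q < 14.
apply: (@wp_le _ _ _ _ (1 + (2 + d * (5 + 3) + 2))); last lia.
apply: wp_seq; apply: (wp_do (a := IConst 16 0)); first by [].
set st1 := set_ireg _ _ _; set nw := ~~ witness _ _ _ _ _ _.
have ag1 : agree A st st1 by exact: agree_ireg.
have Eu1 : vreg st1 13 = Some u by [].
pose bad h := (h == v) || (h \in S) && (h \notin [set x; y]).
have bad_nw h : e u h -> bad h -> nw.
  rewrite /bad /nw /witness; case: eqP => [-> -> _|_ euh /andP[hS hN]].
    by rewrite andbF.
  by apply/negP=> /and3P[_ _ /forall_inP/(_ h hS)]; rewrite euh (negPf hN).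
apply: wp_weaken (wp_flag (r := 16) (Q := nw) (A := A) idP _ _) (leqnn _) _ =>
  //;
  last first.
  by move=> st2 [ag2 E2]; split=> //; exact: agree_trans ag1 ag2.
apply: search_imp.
- apply: search_seq.
    apply: (search_each_adj_const (@flag_resp 16 nw) (B := 5)
      (P := fun h => bad h) _ _ Eu1) => // h st2 euh ag2 Eh.
    have ag02 := agree_trans ag1 ag2.
    have sE2 : sol st2 = S by case: ag02 => ->.
    have Ev2 := agreeV ag02 Ev isT.
    have Ex2 := agreeV ag02 Ex isT.
    have Ey2 := agreeV ag02 Ey isT.
    have leaf b k : b = bad h ->
      search (flag 16 nw) (fun s => ireg s 16 = 1) (predU1 14 A) k.+1 (bad h)
        (if b then Do (IConst 16 1) else Skip) st2.
      move=> ->; apply: search_le (ltn0Sn k).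
      by apply: search_raise => //; exact: bad_nw.
    apply: (@search_if _ _ _ _ _ _ _ (h == v)); first by rewrite /= Eh Ev2.
    case: (boolP (h == v)) => hv; first by apply: (leaf true); rewrite /bad hv.
    apply: (@search_if _ _ _ _ _ _ _ (h \in S)); first by rewrite /= Eh /= sE2.
    case: (boolP (h \in S)) => hS; last first.
      by apply: (leaf false); rewrite /bad (negPf hv) (negPf hS).
    apply: (@search_if _ _ _ _ _ _ _ (h == x)); first by rewrite /= Eh Ex2.
    case: (boolP (h == x)) => hx.
      by apply: (leaf false); rewrite /bad (negPf hv) !inE hx andbF.
    apply: (@search_if _ _ _ _ _ _ _ (h == y)); first by rewrite /= Eh Ey2.
    case: (boolP (h == y)) => hy.
      by apply: (leaf false); rewrite /bad (negPf hv) !inE hy orbT andbF.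
    by apply: (leaf true); rewrite /bad hS !inE (negPf hx) (negPf hy) orbT.
  move=> st2 ag2; have ag02 := agree_trans ag1 ag2.
  apply: (@search_fail_if _ _ _ (u == v)) => //.
    by rewrite /= (agreeV ag02 Eu isT) (agreeV ag02 Ev isT).
  by rewrite /nw /witness => ->.
- by [].
rewrite /nw /witness; case: (boolP (u == v)) => [|uv]; first by right.
rewrite /= negb_and negbK => /orP[euv|/forallPn[h]].
  by left; exists v; rewrite // /bad eqxx.
by rewrite !negb_imply => /and3P[hS euh hN]; left; exists h;
  rewrite // /bad hS hN orbT.
Qed.

Lemma wp_find_witness v x y st :
  sol st = S -> vreg st 6 = Some v -> vreg st 8 = Some x -> vreg st 9 = Some y
    ->
  wp find_witness (30 * (d.+1 * d.+1))
     (fun st1 => agree (fun q => q < 10) st st1 /\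
        if [exists u, e x u && witness e S v x y u]
        then ireg st1 10 = 1 /\ exists u,
               [/\ vreg st1 10 = Some u, e x u & witness e S v x y u]
        else ireg st1 10 = 0) st.
Proof.
move=> sE Ev Ex Ey; have [d1 d2 _] := leq_succ_powers d.
pose A : pred nat := fun q => q < 10.
pose Ok s := ireg s 10 = 0 \/ ireg s 10 = 1 /\ exists u,
               [/\ vreg s 10 = Some u, e x u & witness e S v x y u].
have Okresp s s' : agree (pred1 10) s s' ->
    (Ok s -> Ok s') /\ (ireg s 10 = 1 -> ireg s' 10 = 1).
  by case=> _ _ /(_ 10 isT)[E1 E2 _]; rewrite /Ok E1 E2.
apply: (@wp_le _ _ _ _ (1 + (2 + d * (13 * d.+1 + 4 + 3)))); last first.
  have := leq_mul d1 (leqnn (13 * d.+1 + 4 + 3)); lia.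
apply: wp_seq; apply: (wp_do (a := IConst 10 0)); first by [].
set st1 := set_ireg _ _ _.
have ag1 : agree A st st1 by exact: agree_ireg.
have Ex1 : vreg st1 8 = Some x by [].
apply: (@wp_weaken _ _ _ _ (2 + d * (13 * d.+1 + 4 + 3)) _
  (fun st' => [/\ agree A st1 st', Ok st1 -> Ok st' & ireg st1 10 = 1 \/
    (exists2 u, e x u & witness e S v x y u) -> ireg st' 10 = 1])) => //;
      last first.
  move=> st2 [ag2 ok2 f2]; split; first exact: agree_trans ag1 ag2.
  case: ifPn => [/existsP[u /andP[exu wu]]|/existsPn nw].
    have F : ireg st2 10 = 1 by apply: f2; right; exists u.
    by case: (ok2 (or_introl erefl)); rewrite F.
  case: (ok2 (or_introl erefl)) => // -[_ [u [_ exu wu]]].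
  by have := nw u; rewrite exu wu.
apply: (search_each_adj_const Okresp _ _ Ex1) => // u st2 exu ag2 Eu.
have ag02 := agree_trans ag1 ag2.
have sE2 : sol st2 = S by case: ag02 => ->.
apply: (search_call Okresp).
apply: wp_weaken (wp_test_witness sE2 (agreeV ag02 Ev isT)
  (agreeV ag02 Ex isT) (agreeV ag02 Ey isT) Eu) (leqnn _) _.
move=> st3 [ag3 E16].
have Eu3 := agreeV ag3 Eu isT.
split; [|by apply: agree_sub ag3 _ => q /eqP->|].
  by apply: agree_sub ag3 _ => q; rewrite /A /=; lia.
apply: (search_do Okresp (st1 := set_ireg st3 15 0)) => //;
  [exact: agree_ireg|exact: agree_ireg|].
apply: (@search_if _ _ _ _ _ _ _ (witness e S v x y u)).
  by rewrite /= E16; case: witness.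
case: ifP => [wu|_]; last by apply: search_le; [apply: search_skip|].
exists 2, (set_ireg (set_vreg (set_ireg st3 15 0) 10 u) 10 1); split=> //.
  apply: (@ExecSeq _ _ _ (Do (VCopy 10 13)) _ _ _ _ 1 1).
    by apply: (@ExecDo _ _ _ (VCopy 10 13)); rewrite /= Eu3.
  exact: (@ExecDo _ _ _ (IConst 10 1)).
split=> //; last by move=> _; right; split=> //; exists u.
by split=> // q; rewrite /A => Aq; split=> //=; do !(case: eqP => [?|_];
  first by subst q).
Qed.

Local Notation D2 := (d.+1 * d.+1).
Local Notation D3 := (d.+1 * d.+1 * d.+1).

Lemma search_search3 v st :
  v \notin S -> sol st = S -> vreg st 6 = Some v ->
  main_search (pred2 6 7) (4530 * D3)
    (exists w x y z, improving3 e S v w x y z) search3 st.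
Proof.
move=> vS sE Ev; have [d1 d2 d3] := leq_succ_powers d.
have [eC _] := Ge.
pose st1 := set_ireg st 8 (tau e S v).
(* Three choices each of [x] and [y], at most [d] of [w] and three of [z], each checked in
   [160 * D2]: the leading term is [27 * 160 * D3]. *)
apply: (@search_le _ _ _ _ _ _ (6 * d.+1 + 3 * (6 * d.+1 + 3 *
  (2 + d * (6 * d.+1 + 3 * (160 * D2) + 3)))).+3); last first.
  have := leq_mul d1 (leqnn (6 * d.+1 + 3 * (160 * D2) + 3)); lia.
apply: (search_do found_resp (st1 := st1)) => //;
  [by rewrite /= Ev /= sE (negPf vS)|exact: agree_ireg|exact: agree_ireg|].
apply: (search_do found_resp (st1 := set_ireg st1 9 3)) => //;
  [exact: agree_ireg|exact: agree_ireg|].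
apply: (@search_if _ _ _ _ _ _ _ (tau e S v == 3)); first by [].
case: eqP => tv; last first.
  apply: search_le; last exact: leq0n.
  by apply: search_skip => -[w [x [y [z []]]]].
apply: (search_imp (P := exists2 x, (x \in S) && e v x & exists2 y,
  (y \in S) && e v y & exists2 w, e x w & exists2 z, (z \in S) && e v z &
  good e S v w x y z));
  [|exact: leqnn|]; last first.
  move=> [w [x [y [z [g _ /and3P[evx evy evz] exw]]]]].
  have /and5P[_ /and4P[xS yS zS _] _ _ _] := g.
  exists x; first exact/andP.
  exists y; first exact/andP.
  by exists w => //; exists z => //; exact/andP.
have Ev1 : vreg (set_ireg st1 9 3) 6 = Some v by [].
apply: (search_each_sol found_resp _ _ Ev1) => //; first by rewrite tv.
move=> x st2 xS evx ag2 Ex2.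
have Ev2 := agreeV ag2 Ev1 isT.
have sE2 : sol st2 = S by case: ag2 => ->.
apply: (search_each_sol found_resp _ _ Ev2) => //; first by rewrite tv.
move=> y st3 yS evy ag3 Ey3.
have Ev3 := agreeV ag3 Ev2 isT.
have Ex3 := agreeV ag3 Ex2 isT.
have sE3 : sol st3 = S by case: ag3 => ->.
apply: (search_each_adj_const found_resp _ _ Ex3) => //.
move=> w st4 exw ag4 Ew4.
have Ev4 := agreeV ag4 Ev3 isT.
have Ex4 := agreeV ag4 Ex3 isT.
have Ey4 := agreeV ag4 Ey3 isT.
have sE4 : sol st4 = S by case: ag4 => ->.
apply: (search_each_sol found_resp _ _ Ev4) => //; first by rewrite tv.
move=> z st5 zS evz ag5 Ez5.
apply: search_weaken.
- apply: (@search_check_swap v w x y z) => //.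
  + by rewrite /= xS yS zS.
  + by rewrite eC.
  + by rewrite exw.
  split; [by case: ag5 => ->|exact: agreeV ag5 Ev4 isT|exact: agreeV ag5 Ex4 isT
    |exact: agreeV ag5 Ey4 isT|split=> //; exact: agreeV ag5 Ew4 isT].
- by [].
- by move=> q /=; clear; lia.
- by [].
Qed.

Lemma search_search2 v st :
  v \notin S -> tau e S v = 2 -> sol st = S -> vreg st 6 = Some v ->
  main_search (pred2 6 7) (1600 * D3)
    (exists w x y z, improving2 e S v w x y z) search2 st.
Proof.
move=> vS tv sE Ev; have [d1 d2 d3] := leq_succ_powers d.
have [eC _] := Ge.
(* Two choices each of [x] and [y], one witness search per pair, then at most [d] choices of [w] and
   two of [z]. *)
apply: (@search_le _ _ _ _ _ _ (6 * d.+1 + 2 * (6 * d.+1 + 2 *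
  (30 * D2 + (2 + d * ((6 * d.+1 + 2 * (160 * D2)).+4 + 3)).+2)))); last first.
  have := leq_mul d1 (leqnn ((6 * d.+1 + 2 * (160 * D2)).+4 + 3)); lia.
apply: (search_imp (P := exists2 x, (x \in S) && e v x & exists2 y,
  (y \in S) && e v y & exists w z, improving2 e S v w x y z));
  [|exact: leqnn|]; last first.
  move=> [w [x [y [z I]]]]; have [g _ /and3P[evx evy _] _ _] := I.
  have /and5P[_ /and4P[xS yS zS _] _ _ _] := g.
  exists x; first exact/andP.
  by exists y; [exact/andP|exists w, z].
apply: (search_each_sol found_resp _ _ Ev) => //; first by rewrite tv.
move=> x st2 xS evx ag2 Ex2.
have Ev2 := agreeV ag2 Ev isT.
have sE2 : sol st2 = S by case: ag2 => ->.
apply: (search_each_sol found_resp _ _ Ev2) => //; first by rewrite tv.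
move=> y st3 yS evy ag3 Ey3.
have Ev3 := agreeV ag3 Ev2 isT.
have Ex3 := agreeV ag3 Ex2 isT.
have sE3 : sol st3 = S by case: ag3 => ->.
apply: (search_call found_resp).
apply: wp_weaken (wp_find_witness sE3 Ev3 Ex3 Ey3) (leqnn _) _ => st4 [ag4 W].
have Ev4 := agreeV ag4 Ev3 isT.
have Ex4 := agreeV ag4 Ex3 isT.
have Ey4 := agreeV ag4 Ey3 isT.
have sE4 : sol st4 = S by case: ag4 => ->.
split; [by apply: agree_sub ag4 _ => q /=; clear; lia
       |by apply: agree_sub ag4 _ => q /=; clear; lia|].
apply: (search_do found_resp (st1 := set_ireg st4 11 1)) => //;
  [exact: agree_ireg|exact: agree_ireg|].
apply: (@search_if _ _ _ _ _ _ _ [exists u, e x u && witness e S v x y u]).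
  by move: W; rewrite /=; case: ifP => [_ [-> _]|_ ->].
case: ifPn W => [_ [_ [u [Eu exu wu]]]|/existsPn nw _]; last first.
  apply: search_le; last exact: leq0n.
  apply: search_skip => -[w [z [_ _ _ _ [[u exu wu] _]]]].
  by have := nw u; rewrite exu wu.
(* Whichever witness was found, the [w] of an improving swap is adjacent to it, so scanning the
   neighbours of [u] loses nothing. *)
apply: (search_imp (P := exists2 w, e u w & exists z, improving2 e S v w x y
  z));
  [|exact: leqnn|]; last first.
  move=> [w [z I]]; have [_ _ _ _ [_ /(_ u exu wu) euw]] := I.
  by exists w => //; exists z.
set st5 := set_ireg st4 11 1.
have Eu5 : vreg st5 10 = Some u by exact: Eu.
apply: (search_each_adj_const found_resp _ _ Eu5) => //.
move=> w st6 euw ag6 Ew6.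
have Ev6 := agreeV ag6 (Ev4 : vreg st5 6 = Some v) isT.
have Ex6 := agreeV ag6 (Ex4 : vreg st5 8 = Some x) isT.
have Ey6 := agreeV ag6 (Ey4 : vreg st5 9 = Some y) isT.
have sE6 : sol st6 = S by case: ag6 => ->.
apply: (@search_if _ _ _ _ _ _ _ (w \in S)); first by rewrite /= Ew6 /= sE6.
case: (boolP (w \in S)) => wS.
  apply: search_le; last exact: leq0n.
  by apply: search_skip => -[z [/and5P[_ _ _ /negP]]].
pose st7 := set_ireg st6 13 (tau e S w).
apply: (search_do found_resp (st1 := st7)) => //;
  [by rewrite /= Ew6 /= sE6 (negPf wS)|exact: agree_ireg|exact: agree_ireg|].
pose st8 := set_ireg st7 14 3.
apply: (search_do found_resp (st1 := st8)) => //;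
  [exact: agree_ireg|exact: agree_ireg|].
apply: (@search_if _ _ _ _ _ _ _ (tau e S w < 3)); first by [].
case: ifPn => tw; last first.
  apply: search_le; last exact: leq0n.
  by apply: search_skip => -[z [_ _ _ tw2 _]]; rewrite ltnS tw2 in tw.
apply: (search_imp (P := exists2 z, (z \in S) && e w z & good e S v w x y z));
  [|exact: leqnn|]; last first.
  move=> [z I]; have [g _ /and3P[_ _ ewz] _ _] := I.
  have /and5P[_ /and4P[_ _ zS _] _ _ _] := g.
  by exists z => //; exact/andP.
apply: (search_each_sol found_resp _ _ (Ew6 : vreg st8 11 = Some w)) => //.
move=> z st9 zS ewz ag9 Ez9.
apply: search_weaken.
- apply: (@search_check_swap v w x y z) => //.
  + by rewrite /= xS yS zS.
  + by rewrite eC.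
  + by rewrite [e z w]eC ewz orbT.
  split; [by case: ag9 => ->|exact: agreeV ag9 (Ev6 : vreg st8 6 = Some v) isT
    |exact: agreeV ag9 (Ex6 : vreg st8 8 = Some x) isT
    |exact: agreeV ag9 (Ey6 : vreg st8 9 = Some y) isT
    |split=> //; exact: agreeV ag9 (Ew6 : vreg st8 11 = Some w) isT].
- by [].
- by move=> q /=; clear; lia.
- by [].
Qed.

(** * Performing the swap, and the total time *)

Lemma wp_drop r x (Q : state T -> Prop) st :
  vreg st r = Some x -> x \in sol st -> Q (set_sol e st (sol st :\ x)) ->
  wp (Do (SDrop r)) d.+1 Q st.
Proof.
move=> Er xS Qs; apply: (@wp_le _ _ _ _ (cost e (SDrop r) st)).
  by apply: wp_do Qs; rewrite /= Er /= xS.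
by rewrite /= Er ltnS deg_max.
Qed.

Lemma wp_add r x (Q : state T -> Prop) st :
  vreg st r = Some x -> x \notin sol st -> ~~ dominated e (sol st) x ->
  Q (set_sol e st (x |: sol st)) -> wp (Do (SAdd r)) d.+1 Q st.
Proof.
move=> Er xS nd Qs; apply: (@wp_le _ _ _ _ (cost e (SAdd r) st)).
  by apply: wp_do Qs; rewrite /= Er /= xS tau_eq0 nd.
by rewrite /= Er ltnS deg_max.
Qed.

(** An insertion is defined only at a vertex without solution neighbours. After the three removals
    every intermediate set lies inside the new solution, whose independence makes both insertions
    legal. Integer registers are tracked so that the result flag survives. *)
Lemma wp_perform_swap v w x y z st :
  good e S v w x y z -> sol st = S -> vreg st 1 = Some v ->
  vreg st 2 = Some w -> vreg st 3 = Some x -> vreg st 4 = Some y ->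
  vreg st 5 = Some z ->
  wp perform_swap (5 * d.+1 + 1)
    (fun st' => sol st' = swapped S v w x y z /\ ireg st' = ireg st) st.
Proof.
move=> /and5P[uD /and4P[xS yS zS _] vS wS sol'] sE E1 E2 E3 E4 E5.
move: uD; rewrite /= !inE !negb_or andbT => /andP[/andP[xy xz] yz].
pose S0 := S :\ x :\ y :\ z.
have vin : v \in swapped S v w x y z by rewrite in_swapped eqxx.
have win : w \in swapped S v w x y z by rewrite in_swapped eqxx orbT.
have ES' : swapped S v w x y z = w |: (v |: S0).
  apply/setP=> u; rewrite in_swapped !inE.
  case: (u == v); case: (u == w) => //=.
  by case: (u == x); case: (u == y); case: (u == z); rewrite /= ?andbF ?andbT.
have nd u (A : {set T}) : u \in swapped S v w x y z -> A \subset swapped S v w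
  x y z ->
    ~~ dominated e A u.
  move=> uS' sA; move: (uS'); rewrite (solutionP Ge _ sol') => ndu.
  by apply: contra ndu; exact: dominatedS.
apply: (@wp_le _ _ _ _ (d.+1 + (d.+1 + (d.+1 + (d.+1 + d.+2)))));
  last by clear; lia.
apply: wp_seq; apply: (wp_drop E3); first by rewrite sE.
apply: wp_seq; apply: (wp_drop (x := y));
  [by []|by rewrite /= sE !inE eq_sym xy|].
apply: wp_seq; apply: (wp_drop (x := z)); first by [].
  by rewrite /= sE !inE ![z == _]eq_sym xz yz.
apply: wp_seq; rewrite /= sE -/S0; apply: (wp_add (x := v)); first by [].
- by rewrite /= !inE (negPf vS) !andbF.
- by apply: nd => //; rewrite ES' setUA subsetUr.
apply: (@wp_if _ _ _ _ (v == w)); first by rewrite /= E1 E2.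
case: eqP => [E|/eqP vw].
  apply: (@wp_le _ _ _ _ 0) => //; apply: wp_skip; split=> //=.
  by rewrite ES' -E setUA setUid.
apply: (wp_add (x := w)); first by [].
- by rewrite /= !inE (negPf wS) !andbF orbF eq_sym.
- by apply: nd => //; rewrite ES' subsetUr.
by split=> //=; rewrite ES'.
Qed.

Lemma section_tau st s v :
  sol st = S -> v \in section_seq e st s -> 1 < section_rank s ->
  v \notin S /\ minn (tau e S v) 3 = (section_rank s).-1.
Proof.
move=> sE; rewrite mem_filter sE /rank => /andP[+ _].
by case: (v \in S) => /eqP <-.
Qed.

(* An isolated vertex lies in no section T_t with t > 0. *)
Lemma section_cost st s :
  sol st = S -> perm_eq (ord st) (enum T) -> 1 < section_rank s ->
  size (section_seq e st s) * D3 <= 8 * (#|T| * d ^ 3).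
Proof.
move=> sE pE rs.
have szT : size (section_seq e st s) <= #|T|.
  by rewrite size_filter cardE -(perm_size pE) count_size.
case E: (section_seq e st s) => [|v l] //.
have vl : v \in section_seq e st s by rewrite E mem_head.
have [_ tv] := section_tau sE vl rs.
have d0 : 0 < d.
  apply: leq_trans (deg_max v);
    apply: leq_trans (subset_leq_card (subsetIl _ S)).
  by rewrite -/(tau e S v); clear -tv rs; lia.
rewrite -E !expnS expn0 muln1.
have : d.+1 * d.+1 * d.+1 <= 8 * (d * (d * d)).
  have [k ->] : exists k, d = k.+1 by case: d d0 => // k _; exists k.
  by clear; nia.
by move=> le; apply: leq_trans (leq_mul szT le) _; clear; lia.
Qed.

End Algorithm.

Theorem theorem7 :
  exists (prog : cmd) (C : nat),
    forall (T : finType) (e : rel T) (adj : T -> seq T)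
           (S : {set T}) (st : state T),
      simple_graph e ->
      adjacency_lists e adj ->
      solution e S ->
      minimal e 2 S ->
      maintains e st S ->
      exists (t : nat) (st' : state T),
        [/\ exec e adj prog st t st',
            t <= C * (#|T| * max_degree e ^ 3 + 1) &
            (ireg st' 0 = 1 /\ neighborhood e 3 S (sol st')
               /\ #|sol st'| < #|S|)
            \/ (ireg st' 0 = 0 /\ minimal e 3 S)].
Proof.
(* The two sections cost at most [8 * (4533 + 1603)] = 49088 times [#|T| * d ^ 3]; the swap and the
   overhead fit in the rounding and in the additive 1. *)
exists three_swap_search, (50 * 1000) => T e adj S st Ge adjP solS m2 [sE pE _].
set d := max_degree e.
pose st1 := set_ireg st 0 0.
pose l3 := section_seq e st1 SecT3up; pose l2 := section_seq e st1 SecT2.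
pose D3 := d.+1 * d.+1 * d.+1.
apply: (@wp_le _ _ _ _ (1 + ((3 + size l3 * (4530 * D3 + 3)) +
  ((3 + size l2 * (1600 * D3 + 3)) + (1 + (5 * d.+1 + 1).+1))))
  (50 * 1000 * (#|T| * d ^ 3 + 1))
  (fun st' => (ireg st' 0 = 1 /\ neighborhood e 3 S (sol st')
               /\ #|sol st'| < #|S|) \/ (ireg st' 0 = 0 /\ minimal e 3 S)));
                 last first.
  have := section_cost e (S := S) (st := st1) (s := SecT3up) sE pE isT.
  have := section_cost e (S := S) (st := st1) (s := SecT2) sE pE isT.
  rewrite -/l2 -/l3 -/d -/D3.
  have := leq_pmulr (size l2) (isT : 0 < D3).
  have := leq_pmulr (size l3) (isT : 0 < D3).
  (* This pays for the final swap, whose cost is linear in [d] and is not multiplied by the size of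
     a section. *)
  have : d <= #|T| * d ^ 3.
    have [->//|d0] := posnP d.
    have T0 : 0 < #|T|.
      rewrite lt0n; apply: contraTN d0 => /eqP /card0_eq T0.
      by rewrite /d /max_degree big_pred0.
    by rewrite expnS mulnCA leq_pmulr // muln_gt0 T0 expn_gt0 d0.
  move: (size l2) (size l3) D3 (#|T| * d ^ 3) => s2 s3 D N; clear; lia.
apply: wp_seq; apply: (wp_do (a := IConst 0 0)); first by [].
rewrite -/st1.
apply: wp_seq.
have H3 : search e adj (found e S) (fun s => ireg s 0 = 1) pred0
    (3 + size l3 * (4530 * D3 + 3))
    (exists2 v, v \in l3 & exists w x y z, improving3 e S v w x y z)
    (each_section SecT3up search3) st1.
  apply: (search_each_section (@found_resp _ e S)) => // v st2 vl ag2 Ev.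
  have sE2 : sol st2 = S by case: ag2 => ->.
  have [vS _] := @section_tau _ _ S st1 _ _ sE vl isT.
  exact: search_search3.
apply: wp_weaken H3 (leqnn _) _ => st2 [ag2 ok2 f2].
have sE2 : sol st2 = S by case: ag2 => ->.
apply: wp_seq.
have El2 : section_seq e st2 SecT2 = l2 by rewrite (agree_section _ _ ag2).
have H2 : search e adj (found e S) (fun s => ireg s 0 = 1) pred0
    (3 + size l2 * (1600 * D3 + 3))
    (exists2 v, v \in l2 & exists w x y z, improving2 e S v w x y z)
    (each_section SecT2 search2) st2.
  rewrite -El2.
  apply: (search_each_section (@found_resp _ e S)) => // v st3 vl ag3 Ev.
  have sE3 : sol st3 = S by case: ag3 => ->.
  have [vS tv] := @section_tau _ _ S st2 _ _ sE2 vl isT.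
  by apply: search_search2 => //; move: tv; rewrite /=; lia.
apply: wp_weaken H2 (leqnn _) _ => st3 [ag3 ok3 f3].
have sE3 : sol st3 = S by case: ag3 => ->.
apply: wp_seq; apply: (wp_do (a := IConst 6 1)); first by [].
set st4 := set_ireg _ _ _.
have := ok3 (ok2 (or_introl erefl)).
case=> [F|[F [v [w [x [y [z [g E1 E2 E3 [E4 E5]]]]]]]]].
  apply: (@wp_if _ _ _ _ false); first by rewrite /= F.
  apply: (@wp_le _ _ _ _ 0) => //; apply: wp_skip; right; split=> //.
  move=> S' nb; apply/negP=> lt.
  have notf : ireg st3 0 <> 1 by rewrite F.
  have [v [w [x [y [z I]]]]] := improving_swap Ge solS m2 nb lt.
  (* The [v] of an improving swap lies in a scanned section, so one of the searches would have
     raised the flag. *)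
  have mem s : v \notin S -> minn (tau e S v) 3 = (section_rank s).-1 ->
      0 < section_rank s -> v \in section_seq e st1 s.
    move=> vS tv rs; rewrite mem_filter (perm_mem pE) mem_enum andbT.
    by rewrite /= sE /rank (negPf vS) tv prednK.
  case: notf; apply: f3; case: I => I.
    left; apply: f2; right; exists v; last by exists w, x, y, z.
    by have [/and5P[_ _ vS _ _] tv _ _] := I; apply: mem; rewrite ?tv.
  right; exists v; last by exists w, x, y, z.
  by have [/and5P[_ _ vS _ _] tv _ _ _] := I; apply: mem; rewrite ?tv.
apply: (@wp_if _ _ _ _ true); first by rewrite /= F.
have /and5P[uD sD vS wS sol'] := g.
apply: wp_weaken (wp_perform_swap (st := st4) adj Ge g sE3 E1 E2 E3 E4 E5)
  (leqnn _) _.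
move=> st5 [-> E]; left; rewrite E; split=> //.
by apply: swapped_neighborhood => //; exact/allP.
Qed.
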